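(* Let $K$ be a totally real number field, let $\mathcal O^+$ be the set of totally positive algebraic integers of $K$, and let $k,i$ be integers with $1\le i\le k$. For all $\delta\in\mathcal O^+$, the number $p(\mathscr A'_{k,i},\delta)$ of partitions of $\delta$ belonging to $\mathscr A'_{k,i}$ equals the number $p(\mathscr B'_{k,i},\delta)$ of partitions of $\delta$ belonging to $\mathscr B'_{k,i}$.
   Context: A partition of $\delta\in\mathcal O^+$ is a finite sequence $\lambda=(\lambda_1,\ldots,\lambda_r)$ of elements of $\mathcal O^+$ (the parts) with $\lambda_1+\cdots+\lambda_r=\delta$; partitions are considered (and counted) up to change of order, i.e. as multisets. Each $\delta\in\mathcal O^+$ has only finitely many partitions. An element $\gamma\in\mathcal O^+$ is primitive if $\gamma\notin n\mathcal O^+$ for every rational integer $n\ge 2$; $\mathcal P$ denotes the set of primitive elements. Every $\delta\in\mathcal O^+$ can be written uniquely as $\delta=s(\delta)t(\delta)$ with $s(\delta)\in\mathbb Z^+$ (the scale) and $t(\delta)\in\mathcal P$ (the primitive factor). The sum $\lambda\oplus\lambda'$ of two partitions is their concatenation (multiset union). $\mathscr A'_{k,i}$ is the set of all partitions (of elements of $\mathcal O^+$) each of whose parts has scale not congruent to $0,i,-i$ modulo $2k+1$. For $\gamma\in\mathcal P$, $\mathscr B'_{k,i,\gamma}$ is the set of partitions of the form $(b_1\gamma,b_2\gamma,\ldots,b_m\gamma)$ with integers $b_1\ge b_2\ge\cdots\ge b_m\ge1$ such that $b_j-b_{j+k-1}\ge2$ for all $j$ with $1\le j$ and $j+k-1\le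 m$, and $b_{m-i+1}\ge2$ whenever $m-i+1\ge1$. $\mathscr B'_{k,i}$ is the set of all partitions $\lambda^{(1)}\oplus\cdots\oplus\lambda^{(l)}$ for which there are pairwise distinct $\gamma_1,\ldots,\gamma_l\in\mathcal P$ with $\lambda^{(h)}\in\mathscr B'_{k,i,\gamma_h}$ for all $h$. *)

(* Defs.v *)
From HB Require Import structures.
From mathcomp Require Import all_boot all_order all_algebra all_field.
From mathcomp Require Import finmap multiset.
From mathcomp Require Import boolp classical_sets functions cardinality.

Set Implicit Arguments.
Unset Strict Implicit.
Unset Printing Implicit Defensive.

Import Order.TTheory GRing.Theory Num.Theory.

Local Open Scope classical_set_scope.
Local Open Scope mset_scope.
Local Open Scope ring_scope.

(* A number field is a finite extension of rat.  All its embeddings into the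
   complex numbers take values in the algebraic numbers algC. *)
Definition totally_real (K : fieldExtType rat) : Prop :=
  forall (sigma : {rmorphism K -> algC}) (x : K), sigma x \is Num.real.

Section Partitions.
Variable K : fieldExtType rat.
Implicit Types (x beta gamma delta : K) (lambda : {mset K}) (k i n : nat).

(* In algC, 0 < z means that z is real and positive. *)
Definition totally_positive x : Prop :=
  forall sigma : {rmorphism K -> algC}, 0 < sigma x.

Definition tp_integers : set K :=
  [set x : K | integralOver (intr : int -> K) x /\ totally_positive x].

Definition primitive_elements : set K :=
  [set gamma : K | tp_integers gamma /\
    forall n, (2 <= n)%N -> ~ exists2 beta, tp_integers beta & gamma = beta *+ n].

(* On tp_integers such an n exists and is unique; the default value 0 is only
   taken outside tp_integers. *)
Definition scale delta : nat :=
  xget 0%N [set n : nat | (0 < n)%N /\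
    exists2 gamma, primitive_elements gamma & delta = gamma *+ n].

Definition partitions_of delta : set {mset K} :=
  [set lambda : {mset K} | (forall beta, beta \in lambda -> tp_integers beta) /\
                \sum_(beta <- lambda) beta = delta].

Definition num_partitions (C : set {mset K}) delta : nat :=
  #|` fset_set (C `&` partitions_of delta)|.

Definition A' k i : set {mset K} :=
  [set lambda : {mset K} | forall beta, beta \in lambda -> tp_integers beta /\
    forall r : int, r \in [:: 0; i%:Z; - i%:Z] ->
      ((scale beta)%:Z != r %[mod (2 * k + 1)%N%:Z])%Z].

(* The sequence b is indexed from 0, so that b_j is nth 0 b j.-1; the condition
   b_(m-i+1) >= 2 concerns the entry of index m - i, and m - i + 1 >= 1 means
   i <= m. *)
Definition B'_at k i gamma : set {mset K} :=
  [set lambda : {mset K} | exists b : seq nat,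
    [/\ sorted geq b,
        forall n, n \in b -> (1 <= n)%N,
        forall j, (j + (k - 1) < size b)%N ->
          (nth 0 b (j + (k - 1)) + 2 <= nth 0 b j)%N,
        (i <= size b)%N -> (2 <= nth 0 b (size b - i))%N
      & lambda = seq_mset [seq gamma *+ n | n <- b]]].

Definition B' k i : set {mset K} :=
  [set lambda : {mset K} | exists (l : nat) (gamma : 'I_l -> K) (mu : 'I_l -> {mset K}),
    [/\ injective gamma,
        forall h, primitive_elements (gamma h),
        forall h, B'_at k i (gamma h) (mu h)
      & lambda = \big[@msetD K/mset0]_(h < l) mu h]].

End Partitions.

(* Main.v *)
(* The decomposition by primitive factors turns a partition of delta into a family of
   ordinary partitions of natural numbers, one for each primitive gamma, and membership
   in either class is checked componentwise.  So a size-preserving bijection given by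
   Gordon's theorem can be applied to each component.

   Finiteness: the product of the X - sigma(x) over the embeddings sigma is rational,
   being a characteristic polynomial, and integral when x is, so bounded conjugates
   leave finitely many choices for it.

   Gordon's theorem is proved by generating functions in an arbitrary commutative ring
   with an element q such that q^N = 0, where all sums and products are finite.
   Let B(s, i) count the Gordon partitions with parts > s and fewer than i parts s + 1.
   Both (q; q)_oo B(s, i) and the alternating series [gsum] below satisfy
     F(s, i) = sum_(f < i) q^((s + 1) f) F(s + 1, k - f)
   and agree for s >= N.  At s = 0 the series is evaluated by the Jacobi triple
   product, obtained from the q-binomial theorem.  *)

Require Import Defs.
From HB Require Import structures.
From mathcomp Require Import all_boot all_order all_algebra all_field.
From mathcomp Require Import finmap multiset.
From mathcomp Require Import boolp classical_sets functions cardinality.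
From mathcomp Require Import zify ring.

Set Implicit Arguments.
Unset Strict Implicit.
Unset Printing Implicit Defensive.

Import Order.TTheory GRing.Theory Num.Theory.

Local Open Scope mset_scope.
Local Open Scope ring_scope.

(** * An alternating series and its recurrence *)

Section Nilpotent.
Variables (R : comNzRingType) (q : R) (N : nat).
Hypothesis qN : q ^+ N = 0.

Lemma expr_nil e : (N <= e)%N -> q ^+ e = 0.
Proof. by move=> leNe; rewrite -(subnK leNe) exprD qN mulr0. Qed.

(** Nilpotency of [q] makes [1 - q ^+ e] a unit, with a truncated geometric series as inverse. *)
Lemma lreg_subr_expr e : (0 < e)%N -> GRing.lreg (1 - q ^+ e).
Proof.
move=> e_gt0 y z eqyz.
have inv1 : (\sum_(j < N) (q ^+ e) ^+ j) * (1 - q ^+ e) = 1.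
  by rewrite mulrC -opprB mulNr -subrX1 -exprM expr_nil ?sub0r ?opprK // leq_pmull.
by rewrite -[y]mul1r -[z]mul1r -inv1 -!mulrA eqyz.
Qed.

Lemma lreg_prod_subr_expr (I : Type) (r : seq I) (P : pred I) (e : I -> nat) :
  (forall i, P i -> 0 < e i)%N -> GRing.lreg (\prod_(i <- r | P i) (1 - q ^+ e i)).
Proof.
move=> e_gt0; apply: big_ind => [|x y|i /e_gt0]; [exact: lreg1 | exact: lregM |].
exact: lreg_subr_expr.
Qed.

Lemma mulr_subr_expr a e : (N <= a + e)%N -> q ^+ a * (1 - q ^+ e) = q ^+ a.
Proof. by move=> leN; rewrite mulrBr mulr1 -exprD (expr_nil leN) subr0. Qed.

Variable k : nat.
Hypothesis k_gt0 : (0 < k)%N.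

(* [gterm s n i] is the n-th term of (q; q)_oo J_{k,i}(0; x; q) at x = q^s, where
   J is the function of Andrews; multiplying by (q; q)_oo removes denominators. *)
Definition gterm s n i : R :=
  (-1) ^+ n * q ^+ (k * n * (s + n) + (k - i) * n + 'C(n.+1, 2))
  * (1 - q ^+ ((s + n.*2.+1) * i)) * \prod_(0 <= j < s) (1 - q ^+ (n.+1 + j)).

Definition gsum s i : R := \sum_(0 <= n < N.+1) gterm s n i.

(** [u] and [v] are the two halves of the difference of [gterm] in [i]. Since [v] at [n] and [u] at
    [n.+1] make up one term at [s.+1], shifting the index of [u] yields the recurrence. *)
Let u s n i : R :=
  (-1) ^+ n * q ^+ (k * n * (s + n) + (k - i.+1) * n + 'C(n.+1, 2))
  * \prod_(0 <= j < s.+1) (1 - q ^+ (n + j)).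

Let v s n i : R :=
  (-1) ^+ n * q ^+ (k * n * (s + n) + k * n + 'C(n.+1, 2) + (s + n.+1) * i)
  * \prod_(0 <= j < s.+1) (1 - q ^+ (n.+1 + j)).

(** With A = s + 2n + 1, the bracket (1 - q^(A(i+1))) - q^n (1 - q^(Ai)) equals (1 - q^n) + q^(n +
    Ai) (1 - q^(n+1+s)). The factors 1 - q^n and 1 - q^(n+1+s) extend the product at its lower and
    upper end. *)
Lemma gterm_sub s n i : (i < k)%N -> gterm s n i.+1 - gterm s n i = u s n i + v s n i.
Proof.
move=> ltik; have [d Dk] : exists d, (k = i + d.+1)%N by exists (k - i).-1; lia.
rewrite /gterm /u /v big_nat_recl // big_nat_recr //= addn0.
under [in RHS]eq_bigr => j _ do rewrite addnS -addSn.
set P := \prod_(0 <= j < s) _.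
have -> : (k - i = d.+1)%N by lia.
have -> : (k - i.+1 = d)%N by lia.
set e0 := (k * n * (s + n) + d * n + 'C(n.+1, 2))%N.
have -> : (k * n * (s + n) + d.+1 * n + 'C(n.+1, 2) = e0 + n)%N by rewrite /e0; nia.
have -> : ((s + n.*2.+1) * i.+1 = (s + n.*2.+1) * i + (n + (n.+1 + s)))%N by nia.
have -> : (k * n * (s + n) + k * n + 'C(n.+1, 2) + (s + n.+1) * i
   = e0 + n + (s + n.*2.+1) * i)%N by rewrite /e0 Dk; nia.
rewrite !exprD; ring.
Qed.

Lemma gterm_shift s n i : (i < k)%N ->
  q ^+ (s.+1 * i) * gterm s.+1 n (k - i) = v s n i + u s n.+1 i.
Proof.
move=> ltik; have [d Dk] : exists d, (k = i + d.+1)%N by exists (k - i).-1; lia.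
rewrite /gterm /u /v.
set P := \prod_(0 <= j < s.+1) _.
have -> : (k - (k - i) = i)%N by lia.
have -> : (k - i = d.+1)%N by lia.
have -> : (k - i.+1 = d)%N by lia.
have -> : ('C(n.+2, 2) = 'C(n.+1, 2) + n.+1)%N by rewrite binS bin1.
set e1 := (k * n * (s.+1 + n) + i * n + 'C(n.+1, 2))%N.
have -> : (k * n * (s + n) + k * n + 'C(n.+1, 2) + (s + n.+1) * i = e1 + s.+1 * i)%N.
  by rewrite /e1; nia.
have -> : (k * n.+1 * (s + n.+1) + d * n.+1 + ('C(n.+1, 2) + n.+1)
   = e1 + s.+1 * i + (s.+1 + n.*2.+1) * d.+1)%N by rewrite /e1 Dk; nia.
rewrite !exprD exprS; ring.
Qed.

Lemma gsum0 s : gsum s 0 = 0.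
Proof. by rewrite /gsum big1 // => n _; rewrite /gterm muln0 expr0 subrr mulr0 mul0r. Qed.

Lemma gsumS s i : (i < k)%N ->
  gsum s i.+1 = gsum s i + q ^+ (s.+1 * i) * gsum s.+1 (k - i).
Proof.
move=> ltik; apply/eqP; rewrite addrC -subr_eq; apply/eqP.
rewrite /gsum -sumrB mulr_sumr.
under eq_bigr => n _ do rewrite gterm_sub //.
under [RHS]eq_bigr => n _ do rewrite gterm_shift //.
rewrite !big_split /= addrC; congr (_ + _).
(* The shift of index leaves two boundary terms: the first contains the factor 1 - q^0, the last a
   power of [q] of exponent at least [N]. *)
have u0 : u s 0 i = 0 by rewrite /u big_nat_recl // addn0 expr0 subrr mul0r mulr0.
have uN : u s N.+1 i = 0.
  rewrite /u expr_nil ?mulr0 ?mul0r // binS bin1; nia.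
by rewrite [LHS]big_nat_recl // u0 add0r [RHS]big_nat_recr //= uN addr0.
Qed.

(** For s >= N every term with n > 0 carries a vanishing power of [q]; in the term n = 0 the factor
    1 - q^((s+1)i) is 1 or, for i = 0, zero. *)
Lemma gsum_large s i : (N <= s)%N -> (i <= k)%N ->
  gsum s i = (0 < i)%N%:R * \prod_(0 <= j < s) (1 - q ^+ j.+1).
Proof.
move=> leNs leik; rewrite /gsum big_nat_recl // big1 ?addr0 => [|n _]; last first.
  by rewrite /gterm expr_nil ?mulr0 ?mul0r //; nia.
rewrite /gterm expr0 mul1r !muln0 mul0n !add0n expr0 mul1r.
under eq_bigr => j _ do rewrite add1n.
case: i leik => [|i] leik; first by rewrite muln0 expr0 subrr !mul0r.
by rewrite (@expr_nil (_ * i.+1)) ?subr0 //; nia.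
Qed.

Lemma gsum_rec s i : (i <= k)%N ->
  gsum s i = \sum_(0 <= f < i) q ^+ (s.+1 * f) * gsum s.+1 (k - f).
Proof.
elim: i => [|i IHi] leik; first by rewrite gsum0 big_nil.
by rewrite gsumS // IHi 1?ltnW // big_nat_recr.
Qed.

End Nilpotent.

(** * The Jacobi triple product *)

Lemma binD2 a b : 'C(a + b, 2) = ('C(a, 2) + 'C(b, 2) + a * b)%N.
Proof.
elim: b => [|b IHb]; first by rewrite addn0 muln0 !addn0.
by rewrite addnS !binS !bin1 IHb mulnS; lia.
Qed.

Lemma mulnn_bin a : (a * a = 2 * 'C(a, 2) + a)%N.
Proof. by elim: a => // a IHa; rewrite binS bin1; nia. Qed.

Definition qpoch (R : comNzRingType) (q : R) m : R :=
  \prod_(0 <= j < m) (1 - q ^+ j.+1).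

Lemma qpoch_recr (R : comNzRingType) (q : R) m :
  qpoch q m.+1 = qpoch q m * (1 - q ^+ m.+1).
Proof. by rewrite /qpoch big_nat_recr. Qed.

(** The Gaussian binomial coefficient, defined by a q-Pascal rule so that it makes sense in any
    ring, without division. *)
Fixpoint qbin (R : nzRingType) (Q : R) n j : R :=
  match n, j with
  | _, 0 => 1
  | 0, _.+1 => 0
  | n'.+1, j'.+1 => qbin Q n' j' + Q ^+ j * qbin Q n' j
  end.

Lemma qbin0 (R : nzRingType) (Q : R) n : qbin Q n 0 = 1.
Proof. by case: n. Qed.

Lemma qbinS (R : nzRingType) (Q : R) n j :
  qbin Q n.+1 j.+1 = qbin Q n j + Q ^+ j.+1 * qbin Q n j.+1.
Proof. by []. Qed.

Lemma qbin_small (R : nzRingType) (Q : R) n j : (n < j)%N -> qbin Q n j = 0.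
Proof.
elim: n j => [|n IHn] [|j] //= ltnj.
by rewrite !IHn ?mulr0 ?addr0 // ltnW.
Qed.

Lemma rmorph_qbin (R S : nzRingType) (f : {rmorphism R -> S}) (Q : R) n j :
  f (qbin Q n j) = qbin (f Q) n j.
Proof.
elim: n j => [|n IHn] [|j]; rewrite ?qbin0 ?rmorph1 //; first by rewrite /= rmorph0.
by rewrite !qbinS rmorphD rmorphM rmorphXn /= !IHn.
Qed.

Section QBinomial.
Variable R : comNzRingType.
Implicit Types Q q x y : R.

(** Induction on [n]: once the first factor x + y is removed, the others form the same product with
    y Q in place of y, and the q-Pascal rule recombines the two sums. *)
Lemma qbinomial Q x y n : \prod_(0 <= j < n) (x + y * Q ^+ j) =
  \sum_(0 <= j < n.+1) Q ^+ 'C(j, 2) * qbin Q n j * x ^+ (n - j) * y ^+ j.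
Proof.
elim: n y => [|n IHn] y; first by rewrite big_nil big_nat1 /= !mulr1.
rewrite big_nat_recl // expr0 mulr1.
under eq_bigr => j _ do rewrite exprS mulrA.
rewrite {}IHn [RHS]big_nat_recl // /= mul1r mulr1 subn0 mulrDl addrC.
under [in RHS]eq_bigr => j _.
  rewrite -/(qbin Q n.+1 j.+1) qbinS subSS mulrDr !mulrDl.
  rewrite (_ : Q ^+ 'C(j.+1, 2) * qbin Q n j * x ^+ (n - j) * y ^+ j.+1 =
     y * (Q ^+ 'C(j, 2) * qbin Q n j * x ^+ (n - j) * (y * Q) ^+ j)); last first.
    by rewrite binS bin1 exprD exprMn exprS; ring.
  over.
rewrite big_split /= -mulr_sumr addrCA; congr (_ + _).
rewrite mulr_sumr [LHS]big_nat_recl //= qbin0 !mulr1 mul1r subn0 -exprS mul1r; congr (_ + _).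
rewrite [RHS]big_nat_recr //= qbin_small // !(mulr0, mul0r) addr0.
apply: eq_big_nat => j /andP[_ ltjn].
rewrite -[in RHS](subnSK ltjn) (exprS x) exprMn; ring.
Qed.

(** The quotient formula for Gaussian binomials, cleared of denominators. The inductive step rests
    on 1 - Q^(a+b+2) = (1 - Q^(a+1)) + Q^(a+1) (1 - Q^(b+1)). *)
Lemma qbin_qpoch Q a b :
  qbin Q (a + b) a * (qpoch Q a * qpoch Q b) = qpoch Q (a + b).
Proof.
elim: a b => [|a IHa] b; first by rewrite qbin0 {1}/qpoch big_nil !mul1r.
elim: b => [|b IHb].
  rewrite addn0 qbinS (@qbin_small _ _ a a.+1) // mulr0 addr0.
  by have := IHa 0%N; rewrite addn0 qpoch_recr => IH0; rewrite -[in RHS]IH0; ring.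
rewrite addSn qbinS mulrDl [qpoch Q (a + b.+1).+1]qpoch_recr.
have -> : qbin Q (a + b.+1) a * (qpoch Q a.+1 * qpoch Q b.+1)
        = qpoch Q (a + b.+1) * (1 - Q ^+ a.+1) by rewrite -IHa (qpoch_recr Q a); ring.
have -> : Q ^+ a.+1 * qbin Q (a + b.+1) a.+1 * (qpoch Q a.+1 * qpoch Q b.+1)
        = Q ^+ a.+1 * (1 - Q ^+ b.+1) * qpoch Q (a + b.+1).
  by rewrite addnS -addSn -IHb (qpoch_recr Q b); ring.
by rewrite -addSn [in RHS]exprD; ring.
Qed.


End QBinomial.

Section Jacobi.
Variables (R : comNzRingType) (q : R) (M i : nat).
Hypothesis leiM : (i <= M)%N.

(** The bilateral sum of (-1)^n q^(M C(n,2) + i n) c(m+n) over -m <= n <= m. The second sum runs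
    over the negative indices -(n+1), where C(-(n+1), 2) = C(n+2, 2). *)
Definition jacobi_sum m (c : nat -> R) : R :=
  \sum_(0 <= n < m.+1) (-1) ^+ n * q ^+ (M * 'C(n, 2) + i * n) * c (m + n)%N
  + \sum_(0 <= n < m) (-1) ^+ n.+1 * q ^+ (M * 'C(n.+2, 2) - i * n.+1) * c (m - n.+1)%N.

(* The q-binomial theorem for the factors q^(M m) - q^i q^(M j), j < 2 m; a
   monomial has to be cancelled, hence the regularity of q. *)
Lemma finite_jacobi_lreg m : GRing.lreg q ->
  \prod_(0 <= j < m) (1 - q ^+ (M * j + i))
    * \prod_(0 <= j < m) (1 - q ^+ (M * j.+1 - i))
  = jacobi_sum m (qbin (q ^+ M) (m + m)).
Proof.
(* The monomial to cancel: the factors with j < m each give up - q^i Q^j, the remaining m factors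
   each give up Q^m. *)
move=> regq; set Q := q ^+ M; pose e := (i * m + M * 'C(m, 2) + M * (m * m))%N.
have reg : GRing.lreg ((-1) ^+ m * q ^+ e).
  by apply: lregM; [apply: lreg_sign | apply: lregX].
apply: reg; transitivity (\prod_(0 <= j < m + m) (Q ^+ m + - q ^+ i * Q ^+ j)).
  rewrite [RHS](@big_cat_nat _ _ _ m) ?leq_addr //=.
  rewrite -[X in \prod_(X <= _ < m + m) _]add0n big_addn addnK.
  have -> : \prod_(0 <= j < m) (Q ^+ m + - q ^+ i * Q ^+ (j + m)) =
      q ^+ (M * (m * m)) * \prod_(0 <= j < m) (1 - q ^+ (M * j + i)).
    rewrite (_ : q ^+ (M * (m * m)) = \prod_(0 <= j < m) Q ^+ m); last first.
      by rewrite prodr_const_nat subn0 /Q -!exprM.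
    by rewrite -big_split /=; apply: eq_bigr => j _; rewrite !exprD /Q -!exprM; ring.
  have -> : \prod_(0 <= j < m) (Q ^+ m + - q ^+ i * Q ^+ j) =
     (-1) ^+ m * q ^+ (i * m + M * 'C(m, 2)) * \prod_(0 <= j < m) (1 - q ^+ (M * j.+1 - i)).
    rewrite [in RHS]big_nat_rev /= add0n.
    have -> : (-1) ^+ m * q ^+ (i * m + M * 'C(m, 2)) = \prod_(0 <= j < m) (- (q ^+ i * Q ^+ j)).
      elim: (m) => [|m' IHm]; first by rewrite big_nil muln0 muln0 expr0 mulr1.
      rewrite big_nat_recr //= -IHm binS bin1 mulnS mulnDr /Q -exprM !exprD exprS; ring.
    rewrite -big_split /=; apply: eq_big_nat => j /andP[_ ltjm].
    rewrite !mulNr mulrBr mulr1 opprB /Q -!exprM -!exprD.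
    by congr (q ^+ _ - _); nia.
  by rewrite /e exprD; ring.
rewrite qbinomial.
(* The indices j = m + n give the nonnegative half of [jacobi_sum], and j = m - (n+1), read
   backwards, the negative half. *)
rewrite [LHS](@big_cat_nat _ _ _ m) ?leqW ?leq_addr //= addrC /jacobi_sum mulrDr.
have term j : Q ^+ 'C(j, 2) * qbin Q (m + m) j * (Q ^+ m) ^+ (m + m - j) * (- q ^+ i) ^+ j
    = (-1) ^+ j * q ^+ (M * 'C(j, 2) + M * m * (m + m - j) + i * j) * qbin Q (m + m) j.
  by rewrite (exprNn (q ^+ i)) !exprD !exprM -/Q; ring.
congr (_ + _).
  rewrite -[X in \sum_(X <= _ < _) _ = _]add0n -addSn big_addn addnK mulr_sumr.
  apply: eq_big_nat => n /andP[_ ltnm].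
  rewrite term (addnC n m) binD2 subnDl.
  have -> : (M * ('C(m, 2) + 'C(n, 2) + m * n) + M * m * (m - n) + i * (m + n)
     = e + (M * 'C(n, 2) + i * n))%N.
    have Emn : (m * n + m * (m - n) = m * m)%N by rewrite -mulnDr subnKC.
    by move: (congr1 (muln M) Emn); rewrite /e !mulnDr !mulnA; lia.
  by rewrite !exprD; ring.
rewrite big_nat_rev mulr_sumr /= add0n; apply: eq_big_nat => n /andP[_ ltnm].
rewrite term.
have [d Dm] : exists d, m = (n.+1 + d)%N by exists (m - n.+1)%N; lia.
have -> : (M * 'C(m - n.+1, 2) + M * m * (m + m - (m - n.+1)) + i * (m - n.+1)
   = e + (M * 'C(n.+2, 2) - i * n.+1))%N.
  have lein : (i * n.+1 <= M * 'C(n.+2, 2))%N by rewrite leq_mul // binS bin1 leq_addl.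
  have := congr1 (muln M) (mulnn_bin n.+1).
  have := congr1 (muln M) (binD2 n.+1 d).
  have -> : (m - n.+1 = d)%N by lia.
  have -> : (m + m - d = m + n.+1)%N by lia.
  move: lein; rewrite /e Dm (binS n.+1) bin1.
  set x := 'C(n.+1, 2); set y := 'C(d, 2); set z := 'C(_, 2); nia.
have -> : (-1) ^+ (m - n.+1) = (-1) ^+ m * (-1) ^+ n.+1 :> R.
  by rewrite Dm addKn exprD mulrAC -expr2 sqrr_sign mul1r.
by rewrite exprD; ring.
Qed.
End Jacobi.

(** A polynomial identity: it holds for the regular element 'X of R[X] and is then evaluated at [q],
    which may be nilpotent. *)
Lemma finite_jacobi (R : comNzRingType) (q : R) M i m : (i <= M)%N ->
  \prod_(0 <= j < m) (1 - q ^+ (M * j + i))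
    * \prod_(0 <= j < m) (1 - q ^+ (M * j.+1 - i))
  = jacobi_sum q M i m (qbin (q ^+ M) (m + m)).
Proof.
move=> leiM.
have := congr1 (horner_eval q)
  (@finite_jacobi_lreg {poly R} 'X M i leiM m (monic_lreg (monicX R))).
have evX e : horner_eval q 'X^e = q ^+ e by rewrite rmorphXn /= /horner_eval hornerX.
rewrite rmorphM !rmorph_prod /jacobi_sum rmorphD !rmorph_sum /=.
under eq_bigr => j _ do rewrite rmorphB rmorph1 /= evX.
under [X in _ * X = _]eq_bigr => j _ do rewrite rmorphB rmorph1 /= evX.
move=> ->; congr (_ + _); apply: eq_bigr => j _.
  by rewrite !rmorphM rmorph_sign rmorph_qbin /= !evX.
by rewrite !rmorphM rmorph_sign rmorph_qbin /= !evX.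
Qed.

Section NilpotentJacobi.
Variables (R : comNzRingType) (q : R) (N M i : nat).
Hypotheses (qN : q ^+ N = 0) (i_gt0 : (0 < i)%N) (ltiM : (i < M)%N).

Let Q := q ^+ M.

(** Beside [q ^+ e], every factor of [qpoch] beyond the first [b] acts as 1, because its exponent
    added to [e] is at least [N]. *)
Lemma expr_qpoch e b c : (N <= e + b)%N -> (b <= c)%N ->
  q ^+ e * qpoch Q b = q ^+ e * qpoch Q c.
Proof.
move=> leN /subnKC <-; elim: (c - b)%N => [|d IHd]; first by rewrite addn0.
rewrite addnS qpoch_recr mulrA -IHd mulrAC /Q -exprM (mulr_subr_expr qN) //; nia.
Qed.

Lemma lreg_qpoch b : GRing.lreg (qpoch Q b).
Proof.
rewrite /qpoch; under eq_bigr => j _ do rewrite /Q -exprM.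
by apply: (lreg_prod_subr_expr qN) => j _; rewrite muln_gt0; lia.
Qed.

(** The nilpotent form of the limit of a central Gaussian binomial to 1/(Q; Q)_oo: beside [q ^+ e]
    the products [qpoch] of lengths [N], [x], [y] and [N + N] agree, and the last one is regular. *)
Lemma expr_qbin_qpoch e x y : (x + y = N + N)%N -> (N <= e + x)%N -> (N <= e + y)%N ->
  q ^+ e * qbin Q (N + N) x * qpoch Q N = q ^+ e.
Proof.
move=> Exy lex ley; apply: (@lreg_qpoch (N + N)); rewrite -Exy.
have EN : q ^+ e * qpoch Q N = q ^+ e * qpoch Q x.
  by rewrite (@expr_qpoch e N (N + N)) ?(@expr_qpoch e x (N + N)) //; lia.
transitivity (qpoch Q (x + y) * qbin Q (x + y) x * (q ^+ e * qpoch Q N)); first by ring.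
rewrite EN; transitivity (qbin Q (x + y) x * qpoch Q x * (q ^+ e * qpoch Q (x + y))).
  by ring.
by rewrite -(@expr_qpoch e y) ?leq_addl // -qbin_qpoch; ring.
Qed.

(** The third factors form [qpoch Q N], which turns each Gaussian binomial of [finite_jacobi] into
    1. This works because, by 0 < i < M, the exponent at index n or -n is at least n and so makes up
    for the lower length N - n. *)
Lemma jacobi_nil :
  \prod_(0 <= j < N) ((1 - q ^+ (M * j + i)) * (1 - q ^+ (M * j.+1 - i)) * (1 - q ^+ (M * j.+1)))
  = jacobi_sum q M i N (fun=> 1).
Proof.
rewrite !big_split /= finite_jacobi 1?ltnW // /jacobi_sum.
under [X in _ * X = _]eq_bigr => j _ do rewrite exprM.
rewrite -/(qpoch Q N) mulrDl !mulr_suml.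
congr (_ + _); apply: eq_big_nat => n /andP[_ ltnN]; rewrite mulr1 -!mulrA; congr (_ * _).
  rewrite mulrA (@expr_qbin_qpoch _ _ (N - n)%N) //; first lia; last by nia.
  by nia.
rewrite mulrA (@expr_qbin_qpoch _ _ (N + n.+1)%N) //; first lia; last by nia.
by rewrite binS bin1; nia.
Qed.

End NilpotentJacobi.

(** * Generating functions *)

(** These lists are read as multiplicities: with an offset [s], the entry of index j counts the
    parts equal to s + j + 1. *)
Fixpoint mlists B t : seq (seq nat) :=
  if t is t'.+1 then [seq x :: f | x <- iota 0 B, f <- mlists B t'] else [:: [::]].

Fixpoint weight s (f : seq nat) : nat :=
  if f is x :: f' then (s.+1 * x + weight s.+1 f')%N else 0%N.

Fixpoint supp_mult (P : pred nat) s (f : seq nat) : bool :=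
  if f is x :: f' then ((x == 0%N) || P s.+1) && supp_mult P s.+1 f' else true.

(** [i] is the strict bound for the current multiplicity; after a multiplicity x the next bound is k
    - x, so that adjacent multiplicities add up to less than k. The empty list is treated as a list
    of zeros. *)
Fixpoint gordon_mult (k i : nat) (f : seq nat) : bool :=
  if f is x :: f' then (x < i)%N && gordon_mult k (k - x) f' else (0 < i)%N.

Lemma mem_mlists B t f : (f \in mlists B t) = (size f == t) && all (fun x => x < B)%N f.
Proof.
elim: t f => [|t IHt] [|x f] //.
  by apply/negbTE/allpairsP => -[[y g] [_ _]].
rewrite /= eqSS; apply/allpairsP/idP => [[[y g] /= []]|].
  by rewrite mem_iota add0n /= IHt => ltyB /andP[szg allg] [-> ->]; rewrite ltyB szg allg.
case/and3P=> szf ltxB allf; exists (x, f) => /=.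
by rewrite mem_iota ltxB IHt szf.
Qed.

Lemma mlists_uniq B t : uniq (mlists B t).
Proof.
elim: t => //= t IHt; apply: allpairs_uniq (iota_uniq _ _) IHt _.
by move=> [x f] [y g] _ _ /= [-> ->].
Qed.

Section GeneratingFunctions.
Variables (R : comNzRingType) (q : R) (N : nat).
Hypothesis qN : q ^+ N = 0.

Lemma sum_mlistsS B t s (C : pred (seq nat)) :
  \sum_(f <- mlists B t.+1 | C f) q ^+ weight s f =
  \sum_(0 <= x < B) q ^+ (s.+1 * x) *
     \sum_(f <- mlists B t | C (x :: f)) q ^+ weight s.+1 f.
Proof.
rewrite big_mkcond big_allpairs_dep /= /index_iota subn0; apply: eq_bigr => x _.
by rewrite [in RHS]big_mkcond mulr_sumr; apply: eq_bigr => f _; case: ifP; rewrite ?mulr0 ?exprD.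
Qed.

Lemma sum_supp_mult (P : pred nat) B t s : (0 < B)%N ->
  \sum_(f <- mlists B t | supp_mult P s f) q ^+ weight s f =
  \prod_(s <= j < s + t | P j.+1) \sum_(0 <= x < B) q ^+ (j.+1 * x).
Proof.
move=> B_gt0; elim: t s => [|t IHt] s; first by rewrite addn0 big_geq // big_mkcond big_seq1.
rewrite sum_mlistsS addnS big_ltn_cond ?ltnS ?leq_addr // -addSn -IHt.
case: ifP => Ps /=.
  rewrite mulr_suml; apply: eq_bigr => x _; congr (_ * _).
  by apply: eq_bigl => f; rewrite Ps orbT.
case: B B_gt0 {IHt} => // B _; rewrite big_nat_recl // muln0 expr0 mul1r [X in _ + X]big1 ?addr0 //.
by move=> x _; rewrite big_pred0 ?mulr0 // => f; rewrite Ps.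
Qed.

(** Euler's product: as B >= N, each geometric series cut at [B] is the exact inverse of its factor
    1 - q^(j+1). *)
Lemma supp_mult_gf (P : pred nat) B t s : (0 < B)%N -> (N <= B)%N ->
  \prod_(s <= j < s + t | P j.+1) (1 - q ^+ j.+1)
    * \sum_(f <- mlists B t | supp_mult P s f) q ^+ weight s f = 1.
Proof.
move=> B_gt0 leNB; rewrite sum_supp_mult // -big_split big1 //= => j _.
under eq_bigr => x _ do rewrite exprM.
rewrite big_mkord -opprB mulNr -subrX1 -exprM (expr_nil qN) ?sub0r ?opprK //.
by rewrite (leq_trans leNB) ?leq_pmull.
Qed.

(** Induction on [t] with s + t fixed: the first multiplicity plays the role of f in [gsum_rec], and
    at t = 0 one has s >= N, where [gsum_large] applies. Since B >= k, the entry bound excludes no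
    admissible multiplicity. *)
Lemma gordon_mult_gf k B t s i : (0 < k)%N -> (k <= B)%N -> (i <= k)%N -> (N <= s + t)%N ->
  qpoch q (s + t) * (\sum_(f <- mlists B t | gordon_mult k i f) q ^+ weight s f)
  = gsum q N k s i.
Proof.
move=> k_gt0 lekB; elim: t s i => [|t IHt] s i leik leNst.
  rewrite addn0 in leNst *; rewrite (gsum_large qN) // mulrC big_mkcond big_seq1 /=.
  by case: (0 < i)%N.
rewrite sum_mlistsS (gsum_rec qN) // (big_cat_nat (leq0n i) (leq_trans leik lekB)) /=.
rewrite addrC big_nat_cond big1 ?add0r => [|x /andP[/andP[leix _] _]]; last first.
  by rewrite big_pred0 ?mulr0 // => f; rewrite ltnNge leix.
rewrite mulr_sumr; apply: eq_big_nat => x /andP[_ ltxi].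
rewrite -IHt ?leq_subr ?addSnnS // mulrCA; congr (_ * (_ * _)).
by apply: eq_bigl => f; rewrite ltxi.
Qed.

End GeneratingFunctions.

(** * Gordon's identity for a nilpotent q *)

Definition gordon_residue k i j :=
  [|| j %% (2 * k + 1) == 0, j %% (2 * k + 1) == i | j %% (2 * k + 1) == 2 * k + 1 - i]%N.

Section GordonIdentity.
Variables (R : comNzRingType) (q : R) (N k i : nat).
Hypotheses (qN : q ^+ N = 0) (i_gt0 : (0 < i)%N) (leik : (i <= k)%N).

Let M := (2 * k + 1)%N.

(** At s = 0 the n-th term is the sum of the theta monomials of index -n ([b n]) and n + 1
    ([a n.+1]). Index 0 is shared by [b] and [a], and [a N.+1] vanishes by nilpotency. *)
Lemma gsum_jacobi : gsum q N k 0 i = jacobi_sum q M i N (fun=> 1).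
Proof.
pose a n := (-1) ^+ n * q ^+ (M * 'C(n, 2) + i * n).
pose b n := (-1) ^+ n * q ^+ (M * 'C(n.+1, 2) - i * n).
rewrite /gsum (eq_bigr (fun n => b n + a n.+1)) => [|n _].
  rewrite big_split /= [X in X + _]big_nat_recl // [X in _ + X]big_nat_recr //=.
  have -> : b 0%N = a 0%N by rewrite /a /b !muln0.
  have -> : a N.+1 = 0 by rewrite /a (expr_nil qN) ?mulr0 // mulnS; nia.
  rewrite addr0 addrAC -big_nat_recl // /jacobi_sum.
  by congr (_ + _); apply: eq_bigr => n _; rewrite mulr1.
rewrite /gterm big_geq // mulr1 mulrBr mulr1 /b /a; congr (_ + _).
  have := mulnn_bin n; have -> : 'C(n.+1, 2) = ('C(n, 2) + n)%N by rewrite binS bin1.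
  by move=> E; congr (_ * q ^+ _); rewrite /M; nia.
rewrite exprS mulN1r mulNr -mulrA -exprD; congr (- (_ * q ^+ _)).
have := mulnn_bin n; have -> : 'C(n.+1, 2) = ('C(n, 2) + n)%N by rewrite binS bin1.
by rewrite /M; nia.
Qed.

Lemma prod_gordon_residue :
  \prod_(0 <= j < N * M | gordon_residue k i j.+1) (1 - q ^+ j.+1) =
  \prod_(0 <= j < N) ((1 - q ^+ (M * j + i)) * (1 - q ^+ (M * j.+1 - i)) * (1 - q ^+ (M * j.+1))).
Proof.
rewrite big_mkcond big_nat_mul; apply: eq_bigr => m _.
rewrite -big_mkcond -[X in \prod_(X <= _ < _ | _) _]add0n big_addn mulSn addnK.
(* Each block of M consecutive exponents meets the three residue classes once; the predecessors
   appear because the exponent is [j.+1]. *)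
rewrite -big_filter (perm_big [:: i.-1; (M - i).-1; M.-1]) /=.
  rewrite !big_cons big_nil mulr1 mulrA; congr (_ * _ * _); congr (1 - q ^+ _); rewrite /M; nia.
apply: uniq_perm; first by rewrite filter_uniq ?iota_uniq.
  by rewrite /= !inE !negb_or; apply/and3P; split; rewrite /M; lia.
move=> r; rewrite mem_filter mem_index_iota !inE /gordon_residue -addSn (addnC r.+1) -/M !modnMDl.
have [ltrM|leMr] := ltnP r M; last first.
  rewrite /= andbF; apply/esym/negbTE; by rewrite /M in leMr *; lia.
rewrite /= andbT; have [E|ltrM1] := eqVneq r.+1 M.
  by rewrite E modnn /=; move: E; rewrite /M; lia.
by rewrite modn_small; move: ltrM ltrM1; rewrite /M; lia.
Qed.

(** Multiplied by [qpoch q (N * M)], the Gordon side becomes the theta series, that is, the product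
    over the residues 0, i, -i; on the other side Euler's product cancels all remaining factors. The
    length N M consists of full blocks of residues. *)
Theorem gordon_identity B : (k <= B)%N -> (N <= B)%N ->
  \sum_(f <- mlists B (N * M) | supp_mult (predC (gordon_residue k i)) 0 f) q ^+ weight 0 f
  = \sum_(f <- mlists B (N * M) | gordon_mult k i f) q ^+ weight 0 f.
Proof.
move=> lekB leNB; have reg : GRing.lreg (qpoch q (N * M)) by apply: (lreg_prod_subr_expr qN).
apply: reg.
have k_gt0 : (0 < k)%N by apply: leq_trans leik.
rewrite (@gordon_mult_gf R q N qN k B (N * M) 0) //; last by rewrite leq_pmulr // /M addn1.
rewrite gsum_jacobi -(jacobi_nil qN) //; last by rewrite /M; lia.
rewrite -prod_gordon_residue -[RHS]mulr1.
rewrite -[X in _ = _ * X](@supp_mult_gf R q N qN (predC (gordon_residue k i)) B (N * M) 0) //;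
  last by lia.
rewrite add0n [RHS]mulrA; congr (_ * _).
by rewrite /qpoch (bigID (fun j => gordon_residue k i j.+1)).
Qed.
End GordonIdentity.

(** * Gordon's theorem *)

(** The hypothesis is applied to the class of X in Z[X]/(X^(n+1)), where the coefficient of X^n is
    still visible. *)
Lemma qpoly_sumX_count (I : Type) (r : seq I) (w : I -> nat) (C1 C2 : pred I) n :
  (forall (R : comNzRingType) (q : R), q ^+ n.+1 = 0 ->
    \sum_(f <- r | C1 f) q ^+ w f = \sum_(f <- r | C2 f) q ^+ w f) ->
  count (fun f => C1 f && (w f == n)) r = count (fun f => C2 f && (w f == n)) r.
Proof.
move=> eqgf; pose h : {poly int} := 'X^(n.+1).
have valE p : val (in_qpoly h p) = take_poly n.+1 p.
  by rewrite /= mk_monic_Xn Pdiv.RingMonic.take_poly_rmodp.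
have XN : in_qpoly h 'X ^+ n.+1 = 0.
  rewrite -rmorphXn /=; apply: val_inj; rewrite valE.
  by rewrite -['X^(n.+1)]mul1r take_polyMXn_0.
have sumE (C : pred I) : (\sum_(f <- r | C f) in_qpoly h 'X ^+ w f)
    = in_qpoly h (\sum_(f <- r | C f) 'X^(w f)).
  by rewrite rmorph_sum /=; apply: eq_bigr => f _; rewrite rmorphXn.
have coefE (C : pred I) :
    (\sum_(f <- r | C f) 'X^(w f) : {poly int})`_n = (count (fun f => C f && (w f == n)) r)%:Z.
  rewrite coef_sum -sum1_count -natz natr_sum big_mkcondr /=; apply: eq_bigr => f _.
  by rewrite coefXn eq_sym; case: eqP.
have := eqgf _ _ XN; rewrite !sumE => eqh.
have := congr1 (fun p : {poly %/ h} => (val p)`_n) eqh.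
by rewrite !valE !coef_take_poly ltnSn !coefE => -[].
Qed.

(** * From lists of parts to lists of multiplicities *)

Definition is_part (b : seq nat) := sorted geq b && all (leq 1) b.

Lemma sorted_geq_all x b : sorted geq (x :: b) -> all (geq x) b.
Proof. by move=> /= ; apply: order_path_min => y z w /= leyz lewz; apply: leq_trans lewz leyz. Qed.

(** The entries that are at least [v] form a prefix of a nonincreasing list; v > 0 keeps the default
    value of [nth] below [v]. *)
Lemma leq_nth_count b v p : sorted geq b -> (0 < v)%N ->
  (v <= nth 0%N b p)%N = (p < count (leq v) b)%N.
Proof.
move=> + v_gt0; elim: b p => [|x b IHb] p sb; first by rewrite nth_nil leqNgt v_gt0.
have sb' := path_sorted sb; have/allP lex := sorted_geq_all sb.
have [levx|ltxv] := leqP v x.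
  by case: p => [|p] /=; rewrite levx // add1n ltnS IHb.
have count0 : count (leq v) b = 0%N.
  apply/eqP; rewrite -leqn0 leqNgt -has_count; apply/hasPn => y /lex /= leyx.
  by rewrite -ltnNge (leq_ltn_trans leyx).
case: p => [|p] /=; rewrite count0 (leqNgt v x) ltxv //.
by rewrite IHb // count0.
Qed.

Lemma count_leqS b v : count (leq v) b = (count_mem v b + count (leq v.+1) b)%N.
Proof. by elim: b => //= x b ->; case: ltngtP; lia. Qed.

Definition gordon_seq k i (b : seq nat) :=
  (forall j, (j + (k - 1) < size b)%N -> (nth 0%N b (j + (k - 1)) + 2 <= nth 0%N b j)%N)
  /\ ((i <= size b)%N -> (2 <= nth 0%N b (size b - i))%N).

(** The gap condition says that no k entries in a row lie in {v+1, v+2}. Both sides are compared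
    through the numbers of entries above a threshold. *)
Lemma gordon_seqP k i b : (0 < i)%N -> (i <= k)%N -> is_part b ->
  gordon_seq k i b <-> (count_mem 1 b < i)%N
    /\ forall v, (count_mem v.+1 b + count_mem v.+2 b < k)%N.
Proof.
move=> i_gt0 leik /andP[sb]; rewrite all_count => /eqP szb.
have c1 := count_leqS b 1; split=> [[gap ones]|[ones gap]]; split.
- have [leis|] := leqP i (size b); last by lia.
  by move: (ones leis); rewrite leq_nth_count //; lia.
- move=> v; rewrite ltnNge; apply/negP => lek.
  have cv := count_leqS b v.+1; have cv1 := count_leqS b v.+2.
  (* [p] is the first position with an entry below v + 3. If k entries are v + 1 or v + 2, then
     position p + k - 1 still holds at least v + 1, and the gap forces v + 3 at [p]. *)
  set p := count (leq v.+3) b in cv1.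
  have ltp : (p + (k - 1) < count (leq v.+1) b)%N by lia.
  have lev : (v.+1 <= nth 0 b (p + (k - 1)))%N by rewrite leq_nth_count.
  have /gap : (p + (k - 1) < size b)%N by rewrite (leq_trans ltp) ?count_size.
  move=> le2; have : (v.+3 <= nth 0 b p)%N by lia.
  by rewrite leq_nth_count // ltnn.
- move=> j ltj; set w := nth _ _ (j + _).
  have : (0 < w)%N by rewrite leq_nth_count // szb.
  case Dw : w => [//|v] _; have := gap v.
  have : (j + (k - 1) < count (leq v.+1) b)%N by rewrite -leq_nth_count // -/w Dw.
  rewrite addn2 leq_nth_count //.
  have := count_leqS b v.+1; have := count_leqS b v.+2; lia.
- by move=> leis; rewrite leq_nth_count //; lia.
Qed.

Lemma gordon_multP k i f : (0 < i)%N -> (i <= k)%N ->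
  reflect ((nth 0 f 0 < i)%N /\ forall j, (nth 0 f j + nth 0 f j.+1 < k)%N)
    (gordon_mult k i f).
Proof.
move=> i_gt0 leik; apply: (iffP idP).
  elim: f i i_gt0 leik => [|x f IHf] i i_gt0 leik /=.
    by move=> _; split=> // j; rewrite !nth_nil; lia.
  case/andP=> ltxi /IHf[] => [||f0 gap]; [lia | exact: leq_subr |].
  by split=> // -[|j] //=; lia.
elim: f i i_gt0 leik => [|x f IHf] i i_gt0 leik //= [ltxi gap].
rewrite ltxi IHf ?leq_subr //; first by lia.
by split=> [|j]; [have := gap 0%N => /=; lia | exact: (gap j.+1)].
Qed.

Definition mult_of t (b : seq nat) : seq nat := [seq count_mem j.+1 b | j <- iota 0 t].

Fixpoint of_mult s (f : seq nat) : seq nat :=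
  if f is x :: f' then of_mult s.+1 f' ++ nseq x s.+1 else [::].

Lemma of_mult_gt s f : all (leq s.+1) (of_mult s f).
Proof.
elim: f s => //= x f IHf s; rewrite all_cat; apply/andP; split; last first.
  by apply/allP => y /nseqP[-> _] /=.
by apply: sub_all (IHf s.+1) => y /=; apply: ltnW.
Qed.

Lemma sorted_of_mult s f : sorted geq (of_mult s f).
Proof.
elim: f s => //= x f IHf s; rewrite (sorted_pairwise (rev_trans leq_trans)).
rewrite pairwise_cat -!(sorted_pairwise (rev_trans leq_trans)) IHf /=.
apply/andP; split; last by elim: x => // -[|x] //= ->; rewrite leqnn.
by apply/allrelP => y z /(allP (of_mult_gt _ _)) /= lty /nseqP[-> _]; apply: ltnW.
Qed.

Lemma is_part_of_mult f : is_part (of_mult 0 f).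
Proof. by rewrite /is_part sorted_of_mult of_mult_gt. Qed.

Lemma sumn_of_mult s f : sumn (of_mult s f) = weight s f.
Proof. by elim: f s => //= x f IHf s; rewrite sumn_cat IHf sumn_nseq addnC. Qed.

Lemma count_of_mult s f v : count_mem (s + v).+1 (of_mult s f) = nth 0%N f v.
Proof.
elim: f s v => [|x f IHf] s v /=; first by rewrite nth_nil.
rewrite count_cat count_nseq /=; case: v => [|v] /=.
  rewrite addn0 eqxx mul1n (_ : count _ _ = 0%N) //.
  apply/eqP; rewrite -leqn0 leqNgt -has_count; apply/hasPn => y /(allP (of_mult_gt _ _)) /=.
  by rewrite eq_sym => /gtn_eqF; rewrite eq_sym => ->.
by rewrite addnS -addSn IHf eqSS ltn_eqF ?mul0n ?addn0 // ltnS leq_addr.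
Qed.

Lemma nth_mult_of t b j : nth 0%N (mult_of t b) j = if (j < t)%N then count_mem j.+1 b else 0%N.
Proof.
case: ltnP => [ltjt|letj]; first by rewrite (nth_map 0%N) ?size_iota // nth_iota.
by rewrite nth_default // size_map size_iota.
Qed.

Lemma of_multK t f : size f = t -> mult_of t (of_mult 0 f) = f.
Proof.
move=> szf; apply: (@eq_from_nth _ 0%N); first by rewrite size_map size_iota.
move=> j; rewrite size_map size_iota => ltjt.
by rewrite nth_mult_of ltjt -(count_of_mult 0).
Qed.

Lemma mult_ofK t b : is_part b -> all (geq t) b -> of_mult 0 (mult_of t b) = b.
Proof.
move=> /andP[sb posb] leb.
apply: (sorted_eq (rev_trans leq_trans) _ (sorted_of_mult _ _) sb).
  by move=> x y /= /andP[lexy leyx]; apply/eqP; rewrite eqn_leq; apply/andP.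
apply/allP => v _ /=; case: v => [|v].
  rewrite !(count_memPn _) //; apply/negP.
    by move/(allP posb).
  by move/(allP (of_mult_gt _ _)).
rewrite (count_of_mult 0) nth_mult_of; case: ltnP => // letv.
by apply/eqP/esym/count_memPn/negP => /(allP leb) /=; rewrite leqNgt ltnS letv.
Qed.

Lemma weight_mult_of t b : is_part b -> all (geq t) b -> weight 0 (mult_of t b) = sumn b.
Proof. by move=> partb leb; rewrite -sumn_of_mult mult_ofK. Qed.

Lemma supp_multP (P : pred nat) s f :
  reflect (forall j, (0 < nth 0 f j)%N -> P (s + j).+1) (supp_mult P s f).
Proof.
apply: (iffP idP); elim: f s => [|x f IHf] s //=.
- by move=> _ j; rewrite nth_nil.
- case/andP=> Px /IHf Pf [|j] /=; last by rewrite addnS -addSn; apply: Pf.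
  by rewrite addn0; case: x Px => [|x].
move=> Pf; apply/andP; split; last first.
  by apply: IHf => j /(Pf j.+1); rewrite addnS.
by case: x Pf => //= x /(_ 0%N); rewrite addn0; apply.
Qed.

Lemma supp_mult_of (P : pred nat) t b : is_part b -> all (geq t) b ->
  supp_mult P 0 (mult_of t b) = all P b.
Proof.
move=> /andP[_ posb] leb; apply/supp_multP/allP => [Pb x bx|Pb j].
  have x_gt0 : (0 < x)%N := allP posb x bx.
  have := Pb x.-1; rewrite nth_mult_of add0n prednK //.
  by rewrite (allP leb _ bx : (x <= t)%N); apply; rewrite -has_count has_pred1.
rewrite nth_mult_of; case: ifP => // _; rewrite -has_count has_pred1; exact: Pb.
Qed.

Lemma gordon_mult_of k i t b : (0 < i)%N -> (i <= k)%N -> (0 < t)%N ->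
  is_part b -> all (geq t) b -> gordon_mult k i (mult_of t b) <-> gordon_seq k i b.
Proof.
move=> i_gt0 leik t_gt0 partb leb.
have nthE j : nth 0%N (mult_of t b) j = count_mem j.+1 b.
  rewrite nth_mult_of; case: ltnP => // letj; apply/esym/count_memPn/negP.
  by move/(allP leb) => /=; rewrite leqNgt ltnS letj.
split=> [/(gordon_multP _ i_gt0 leik)|/(gordon_seqP i_gt0 leik partb)] [f0 gap].
  by apply/(gordon_seqP i_gt0 leik partb); split=> [|v]; rewrite -!nthE.
by apply/(gordon_multP _ i_gt0 leik); split=> [|v]; rewrite !nthE.
Qed.

Definition enumerates (n : nat) (C : seq nat -> Prop) (U : seq (seq nat)) :=
  uniq U /\ forall b, b \in U <-> [/\ is_part b, sumn b = n & C b].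

(** In a partition of [n] both the parts and the multiplicities are at most [n], so the lists of
    length t >= n with entries below B > n miss none. *)
Lemma enumerates_of_mult B t n (C : seq nat -> Prop) (c : pred (seq nat)) :
  (n < B)%N -> (n <= t)%N ->
  (forall b, is_part b -> all (geq t) b -> c (mult_of t b) <-> C b) ->
  enumerates n C [seq of_mult 0 f | f <- mlists B t & c f && (weight 0 f == n)].
Proof.
move=> ltnB lent cC; split.
  rewrite map_inj_in_uniq ?filter_uniq ?mlists_uniq // => f g.
  rewrite !mem_filter !mem_mlists => /and3P[_ /eqP szf _] /and3P[_ /eqP szg _].
  by move/(congr1 (mult_of t)); rewrite !of_multK.
move=> b; split.
  case/mapP=> f; rewrite mem_filter mem_mlists => /and3P[/andP[cf /eqP wf] /eqP szf ltf] ->.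
  split; [exact: is_part_of_mult | by rewrite sumn_of_mult |].
  apply/cC; rewrite ?is_part_of_mult ?of_multK //.
  apply/allP => x; case: x => [|x] //=; rewrite -has_pred1 has_count (count_of_mult 0).
  by rewrite -szf; case: (ltnP x (size f)) => // lefx; rewrite nth_default.
case=> partb sumb Cb.
have leb : all (geq t) b.
  apply/allP => x bx /=; rewrite (leq_trans _ lent) // -sumb.
  by rewrite (perm_sumn (perm_to_rem bx)) /= leq_addr.
apply/mapP; exists (mult_of t b); last by rewrite mult_ofK.
rewrite mem_filter mem_mlists weight_mult_of // sumb eqxx andbT size_map size_iota eqxx /=.
apply/andP; split; first by apply/cC.
apply/allP => _ /mapP[j _ ->]; rewrite (leq_ltn_trans _ ltnB) // -sumb.
have /andP[_ posb] := partb; rewrite (leq_trans (count_size _ _)) //.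
by elim: b posb {partb sumb Cb leb} => //= x b IHb /andP[x_gt0 /IHb]; lia.
Qed.

Theorem gordon_enum k i n : (0 < i)%N -> (i <= k)%N ->
  exists U V, [/\ size U = size V,
    enumerates n (fun b => all (predC (gordon_residue k i)) b) U
    & enumerates n (gordon_seq k i) V].
Proof.
(* The values serve [gordon_identity] with nilpotency exponent [n.+1], which is enough to read off
   the coefficient of q^n. *)
move=> i_gt0 leik; pose B := (k + n.+1)%N; pose t := (n.+1 * (2 * k + 1))%N.
have lent : (n <= t)%N by rewrite /t; nia.
exists [seq of_mult 0 f | f <- mlists B t
          & supp_mult (predC (gordon_residue k i)) 0 f && (weight 0 f == n)],
       [seq of_mult 0 f | f <- mlists B t & gordon_mult k i f && (weight 0 f == n)].
split.
- rewrite !size_map !size_filter; apply: qpoly_sumX_count => R q qn.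
  by apply: (gordon_identity qn); rewrite // /B ?leq_addr ?leq_addl.
- apply: enumerates_of_mult => [|//|b partb leb]; first by rewrite /B; lia.
  by rewrite supp_mult_of.
apply: enumerates_of_mult => [|//|b partb leb]; first by rewrite /B; lia.
by apply: gordon_mult_of => //; rewrite /t; nia.
Qed.

(** * Embeddings and finiteness *)

Section Embeddings.
Variable K : fieldExtType rat.

(** The embedding sends p(theta) to p(r); the choice of [p] is irrelevant because [f] divides the
    difference of two choices and vanishes at [r]. *)
Lemma embedding_of_root (theta : K) (f : {poly rat}) (r : algC) :
  (forall p : {poly rat}, (map_poly (in_alg K) p).[theta] = 0 -> f %| p) ->
  (forall x : K, exists p : {poly rat}, x = (map_poly (in_alg K) p).[theta]) ->
  root (map_poly ratr f) r ->
  exists sigma : {rmorphism K -> algC}, sigma theta = r.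
Proof.
move=> idealf genK rootr; pose ev (p : {poly rat}) : algC := (map_poly ratr p).[r].
have ev0 p : (map_poly (in_alg K) p).[theta] = 0 -> ev p = 0.
  move/idealf => fp; apply/rootP; apply: root_dvdp rootr.
  by rewrite dvdp_map.
pose s x := ev (sval (cid (genK x))).
have sE p x : x = (map_poly (in_alg K) p).[theta] -> s x = ev p.
  move=> Dx; rewrite /s; case: cid => p' /= Dx'; apply/eqP; rewrite -subr_eq0.
  rewrite /ev -hornerN -hornerD -rmorphN -rmorphD; apply/eqP/ev0.
  by rewrite rmorphB hornerD hornerN -Dx -Dx' subrr.
have s_add : zmod_morphism s.
  move=> x y; have [[p Dp] [p' Dp']] := (genK x, genK y).
  rewrite (sE _ _ Dp) (sE _ _ Dp') (sE (p - p')) /ev ?rmorphB ?hornerD ?hornerN //.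
  by rewrite -Dp -Dp'.
have s_mul : monoid_morphism s.
  split=> [|x y]; first by rewrite (sE 1) /ev ?rmorph1 ?hornerC.
  have [[p Dp] [p' Dp']] := (genK x, genK y).
  rewrite (sE _ _ Dp) (sE _ _ Dp') (sE (p * p')) /ev ?rmorphM ?hornerM //.
  by rewrite -Dp -Dp'.
pose sM := GRing.isMonoidMorphism.Build K algC s s_mul.
pose sA := GRing.isZmodMorphism.Build K algC s s_add.
pose sigma : {rmorphism K -> algC} := HB.pack s sM sA.
by exists sigma; rewrite /= (sE 'X) /ev ?map_polyX ?hornerX.
Qed.

Lemma embeddings_exist : exists (n : nat) (theta : K) (sigma : 'I_n.+1 -> {rmorphism K -> algC}),
  injective (fun j => sigma j theta) /\
  forall x : K, exists2 p : {poly rat}, (size p <= n.+1)%N & x = (map_poly (in_alg K) p).[theta].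
Proof.
have char0 : has_char0 K by move=> p; rewrite pchar_lalg pchar_num.
(* Primitive element theorem; extensions in characteristic 0 are separable. *)
have [theta genK] : exists theta : K, {:K}%VS = <<1; theta>>%VS.
  exists (separable_generator 1 {:K}); apply: eq_adjoin_separable_generator (sub1v _).
  by apply/separableP => y _; apply: pcharf0_separable.
have [f Df] : exists f, minPoly 1 theta = map_poly (in_alg K) f.
  exact/polyOver1P/minPolyOver.
have sz_f : size f = (adjoin_degree 1 theta).+1 by rewrite -size_minPoly Df size_map_poly.
have f_neq0 : f != 0 by rewrite -size_poly_gt0 sz_f.
have idealf p : (map_poly (in_alg K) p).[theta] = 0 -> f %| p.
  move=> p0; rewrite -(dvdp_map (in_alg K)) -Df; apply: minPoly_dvdp; last exact/rootP.
  by apply/polyOver1P; exists p.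
have genp x : exists p : {poly rat}, x = (map_poly (in_alg K) p).[theta].
  have /Fadjoin_polyP[p /polyOver1P[q ->] ->] : x \in <<1; theta>>%VS.
    by rewrite -genK memvf.
  by exists q.
have [r Dr] := closed_field_poly_normal (map_poly (@ratr algC) f).
have lead_neq0 : lead_coef (map_poly (@ratr algC) f) != 0.
  by rewrite lead_coef_eq0 map_poly_eq0.
have sz_r : size r = adjoin_degree 1 theta.
  have := size_map_poly (@ratr algC) f; rewrite Dr size_scale // size_prod_XsubC sz_f.
  by case.
have uniq_r : uniq r.
  rewrite -separable_prod_XsubC.
  suff : separable_poly (map_poly (@ratr algC) f).
    by rewrite Dr (eqp_separable (eqp_scale _ lead_neq0)).
  by rewrite separable_map -(separable_map (in_alg K)) -Df; apply: pcharf0_separable.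
have [n Dn] : exists n, size r = n.+1.
  by exists (size r).-1; rewrite prednK // sz_r adjoin_degreeE divn_gt0
       ?adim_gt0 ?dimvS ?subv_adjoin.
(* One embedding per root of the minimal polynomial; for indices beyond the roots the first root
   serves as a default. *)
have sig j : exists sigma : {rmorphism K -> algC}, (j < size r)%N -> sigma theta = r`_j.
  have [ltj|lej] := ltnP j (size r); last first.
    have [|s _] := @embedding_of_root theta f r`_0 idealf genp; last by exists s.
    by rewrite Dr rootZ // root_prod_XsubC mem_nth // Dn.
  have [|s Ds] := @embedding_of_root theta f r`_j idealf genp; last by exists s.
  by rewrite Dr rootZ // root_prod_XsubC mem_nth.
pose sigma (j : 'I_n.+1) := sval (cid (sig j)).
have sigmaE j : sigma j theta = r`_j.
  by rewrite /sigma; case: cid => s /= ->; rewrite // Dn.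
exists n, theta, sigma; split.
  move=> j j'; rewrite !sigmaE => /eqP; rewrite nth_uniq ?Dn // => /eqP; exact: val_inj.
move=> x; have [p Dp] := genp x; exists (p %% f).
  by rewrite -ltnS -Dn sz_r -sz_f ltn_modp.
have fth : (map_poly (in_alg K) f).[theta] = 0 by rewrite -Df; apply/rootP/root_minPoly.
by rewrite Dp {1}(divp_eq p f) rmorphD rmorphM hornerD hornerM fth mulr0 add0r.
Qed.

End Embeddings.

(** A factor X - z replaces a polynomial by its shift minus z times itself, so a bound on all
    coefficients grows at most by the factor 1 + B. *)
Lemma coef_prod_XsubC_bound (R : numDomainType) (I : Type) (r : seq I) (z : I -> R) (B : R) i :
  (forall j, `|z j| <= B) -> 0 <= B ->
  `|(\prod_(j <- r) ('X - (z j)%:P))`_i| <= (1 + B) ^+ size r.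
Proof.
move=> zB B_ge0; elim: r i => [|a r IHr] i.
  by rewrite big_nil coef1; case: eqP; rewrite ?normr1 ?normr0 ?ler01.
rewrite big_cons mulrBl coefB coefXM coefCM exprS mulrDl mul1r.
apply: le_trans (ler_normB _ _) _; apply: lerD.
  by case: ifP => // _; rewrite normr0 exprn_ge0 // addr_ge0.
by rewrite normrM ler_pM.
Qed.

Lemma finite_int_polys n b :
  finite_set [set p : {poly int} | (size p <= n)%N /\ forall i, (absz (p`_i)%R <= b)%N].
Proof.
(* Each coefficient is coded by its absolute value and its sign. *)
pose F (f : {ffun 'I_n -> 'I_b.+1 * bool}) : {poly int} :=
  \poly_(i < n) (if insub i is Some j then (-1) ^+ (f j).2 * (f j).1%:Z else 0).
apply: (@sub_finite_set _ _ (F @` setT)); last exact: finite_image.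
move=> p [szp pb]; exists [ffun j : 'I_n => (inord (absz p`_j), p`_j < 0)] => //.
apply/polyP => i; rewrite coef_poly; case: ifP => [lti|]; last first.
  by move/negbT; rewrite -leqNgt => lei; rewrite nth_default // (leq_trans szp).
by rewrite insubT ffunE /= inordK ?ltnS // abszE -intEsign.
Qed.

Section Finiteness.
Variables (K : fieldExtType rat) (n : nat) (theta : K).
Variable sigma : 'I_n.+1 -> {rmorphism K -> algC}.
Hypothesis sigma_inj : injective (fun j => sigma j theta).
Hypothesis genK : forall x : K,
  exists2 p : {poly rat}, (size p <= n.+1)%N & x = (map_poly (in_alg K) p).[theta].

(* Multiplication by x has the matrix M in the basis theta^k, and the Vandermonde
   matrix of the conjugates of theta diagonalizes it. *)
Lemma conjugates_poly_rat (x : K) :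
  exists P : {poly rat}, map_poly ratr P = \prod_j ('X - (sigma j x)%:P).
Proof.
have genp y : exists p : {poly rat}, (size p <= n.+1)%N /\ y = (map_poly (in_alg K) p).[theta].
  by have [p] := genK y; exists p.
pose M : 'M[rat]_n.+1 := \matrix_(k, l) (sval (cid (genp (x * theta ^+ k))))`_l.
have ME (k : 'I_n.+1) : x * theta ^+ k = \sum_l M k l *: theta ^+ l.
  under eq_bigr => l _ do rewrite mxE.
  case: cid => p [/= szp {1}->]; rewrite (horner_coef_wide (n := n.+1)) ?size_map_poly //.
  by apply: eq_bigr => l _; rewrite coef_map /= mulr_algl.
pose V := Vandermonde n.+1 (\row_j sigma j theta).
pose D := diag_mx (\row_j sigma j x).
have MV : map_mx (@ratr algC) M *m V = V *m D.
  apply/matrixP => k j; rewrite mul_mx_diag !mxE.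
  have := congr1 (sigma j) (ME k); rewrite rmorphM rmorphXn rmorph_sum /= mulrC => ->.
  by apply: eq_bigr => l _; rewrite !mxE rmorphZ_num rmorphXn.
have detV : \det V != 0.
  rewrite det_Vandermonde; apply/prodf_neq0 => i _; apply/prodf_neq0 => j ltij.
  by rewrite !mxE subr_eq0; apply: contraTneq ltij => /sigma_inj ->; rewrite ltnn.
(* Similarity without inverting V: (X - M) V = V (X - D), and det V is cancelled. *)
have charM : char_poly (map_mx (@ratr algC) M) = char_poly D.
  apply: (@mulIf _ (\det (map_mx polyC V))); first by rewrite det_map_mx polyC_eq0.
  rewrite /char_poly -det_mulmx mulrC -det_mulmx; congr (\det _).
  rewrite /char_poly_mx mulmxBl mulmxBr -!map_mxM MV; congr (_ - _).
  by rewrite mul_scalar_mx mul_mx_scalar.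
exists (char_poly M); rewrite map_char_poly charM char_poly_trig ?diag_mx_is_trig //.
by apply: eq_bigr => j _; rewrite !mxE eqxx.
Qed.

Lemma Aint_integral (s : {rmorphism K -> algC}) x :
  integralOver (intr : int -> K) x -> s x \in Aint.
Proof.
case=> p monp rootp; apply: (@root_monic_Aint (map_poly intr p)).
- move: rootp; rewrite -(fmorph_root s) -map_poly_comp.
  by rewrite (eq_map_poly (g := intr)) // => z /=; rewrite rmorph_int.
- exact: monic_map.
by apply/polyOverP => i; rewrite coef_map /= intr_int.
Qed.

(** The coefficients are rational and are algebraic integers, hence integers. *)
Lemma conjugates_poly_int (x : K) : integralOver (intr : int -> K) x ->
  exists p : {poly int}, map_poly intr p = \prod_j ('X - (sigma j x)%:P).
Proof.
move=> intx; have [P DP] := conjugates_poly_rat x.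
have /polyOverP intP : \prod_j ('X - (sigma j x)%:P) \is a polyOver Num.int.
  apply/polyOverP => i; apply: Cint_rat_Aint; first by rewrite -DP coef_map Crat_rat.
  move: i; apply/polyOverP/rpred_prod => j _; rewrite rpredB ?polyOverX ?polyOverC //.
  exact: Aint_integral.
exists (map_poly Num.floor (\prod_j ('X - (sigma j x)%:P))).
apply/polyP => i; rewrite coef_map coef_map_id0 ?floor0 //=.
by rewrite floorK.
Qed.

Lemma finite_bounded_conjugates (B : algC) : 0 <= B ->
  finite_set [set x : K | integralOver (intr : int -> K) x /\ forall j, `|sigma j x| <= B].
Proof.
move=> B_ge0; pose b := Num.truncn ((1 + B) ^+ n.+1).
pose S := [set p : {poly int} | (size p <= n.+2)%N /\ forall i, (absz (p`_i)%R <= b)%N]%classic.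
have sz_enum : size (index_enum 'I_n.+1) = n.+1.
  by rewrite [index_enum _]unlock -enumT size_enum_ord.
(* The zero polynomial is excluded, since it would have every element as a root. *)
pose rts (p : {poly int}) : set K := [set x | p != 0 /\ root (map_poly intr p) (sigma ord0 x)]%classic.
apply: (@sub_finite_set _ _ (\bigcup_(p in S) rts p)).
  move=> x [intx xB]; have [p Dp] := conjugates_poly_int intx.
  have szp : size p = n.+2.
    have := size_map_inj_poly (@intr_inj algC) (mulr0z _) p; rewrite Dp size_prod_XsubC.
    by rewrite sz_enum => <-.
  exists p; last first.
    split; first by rewrite -size_poly_gt0 szp.
    by rewrite Dp (bigD1 ord0) //= rootM root_XsubC eqxx.
  split=> [|i]; first by rewrite szp.
  have : `|(map_poly intr p : {poly algC})`_i| <= (1 + B) ^+ n.+1.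
    rewrite Dp; apply: le_trans (coef_prod_XsubC_bound _ _ xB B_ge0) _.
    by rewrite sz_enum.
  rewrite coef_map /= -intr_norm -abszE => le1.
  by rewrite /b truncn_ge_nat // exprn_ge0 // addr_ge0.
apply: bigcup_finite => [|p _]; first exact: finite_int_polys.
have [->|p_neq0] := eqVneq p 0.
  by apply: (@sub_finite_set _ _ set0) => // x [/eqP].
have [r Dr] := closed_field_poly_normal (map_poly intr p : {poly algC}).
apply: (@sub_finite_set _ _ ((sigma ord0 : K -> algC) @^-1` [set` r])).
  move=> x [_] /=; rewrite Dr rootZ ?root_prod_XsubC //.
  by rewrite lead_coef_eq0 map_poly_eq0_id0 // intr_eq0 lead_coef_eq0.
apply: finite_preimage; last exact: finite_seq.
by move=> x y _ _; apply: fmorph_inj.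
Qed.

End Finiteness.


Lemma count_flatten_nseq (T : eqType) (f : T -> nat) (s : seq T) (x : T) : uniq s ->
  count_mem x (flatten [seq nseq (f y) y | y <- s]) = if x \in s then f x else 0%N.
Proof.
elim: s => //= y s IHs /andP[nsy /IHs IH]; rewrite count_cat count_nseq IH inE /= eq_sym.
case: eqVneq => [->|_] /=; last by rewrite mul0n.
by rewrite (negbTE nsy) mul1n addn0.
Qed.

(** * Totally positive integers and finiteness of partitions *)

Section TotallyPositive.
Variable K : fieldExtType rat.
Implicit Types (x y beta gamma delta : K) (lambda : {mset K}).

Lemma embedding_exists : exists sigma : {rmorphism K -> algC}, True.
Proof. by have [n [theta [sigma _]]] := embeddings_exist K; exists (sigma ord0). Qed.

Lemma tp_add x y : tp_integers x -> tp_integers y -> tp_integers (x + y).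
Proof.
move=> [intx posx] [inty posy]; split; first exact: integral_add.
by move=> s; rewrite rmorphD addr_gt0.
Qed.

Lemma tp_mulrn x n : (0 < n)%N -> tp_integers x -> tp_integers (x *+ n).
Proof.
by case: n => // n _ tpx; elim: n => [//|n IHn]; rewrite mulrS; apply: tp_add.
Qed.

Lemma mulrn_inj n : (0 < n)%N -> injective (fun x => x *+ n).
Proof.
move=> n_gt0 x y /= /eqP; rewrite -subr_eq0 -mulrnBl -mulr_natr mulf_eq0.
have -> : n%:R == 0 :> K = false.
  have [s _] := embedding_exists.
  by rewrite -(fmorph_eq0 s) rmorph_nat pnatr_eq0; case: n n_gt0.
by rewrite orbF subr_eq0 => /eqP.
Qed.

Lemma finite_tp_below delta :
  finite_set [set beta | tp_integers beta /\
    forall sigma : {rmorphism K -> algC}, sigma beta <= sigma delta].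
Proof.
have [n [theta [sigma [sigma_inj genK]]]] := embeddings_exist K.
(* By positivity the conjugates of [x] are bounded in absolute value by those of [delta]; the sum
   gives one bound for all embeddings. *)
apply: (sub_finite_set (B := [set x : K | integralOver (intr : int -> K) x
    /\ forall j, `|sigma j x| <= \sum_j `|sigma j delta|]%classic)); last first.
  by apply: (finite_bounded_conjugates sigma_inj genK); apply: sumr_ge0 => j _.
move=> x [[intx posx] lex]; split=> // j.
have x_ge0 : 0 <= sigma j x by apply: ltW.
rewrite (ger0_norm x_ge0) (bigD1 j) //= (le_trans (lex (sigma j))) //.
by rewrite ger0_norm ?(le_trans x_ge0) // lerDl sumr_ge0.
Qed.

(** The other parts have positive image. This bounds at once the conjugates of a part and its
    multiplicity. *)
Lemma rmorph_part_le (sigma : {rmorphism K -> algC}) lambda beta :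
  (forall x, x \in lambda -> tp_integers x) ->
  sigma beta *+ lambda beta <= sigma (\sum_(x <- lambda) x).
Proof.
move=> tpl; rewrite -count_mem_mset rmorph_sum /= [X in _ <= X](bigID (pred1 beta)) /=.
rewrite (eq_bigr (fun=> sigma beta)) => [|x /eqP-> //].
rewrite big_const_seq iter_addr_0 lerDl big_seq_cond sumr_ge0 // => x /andP[/tpl[_ posx] _].
exact: ltW.
Qed.

Lemma finite_partitions delta : finite_set (partitions_of delta).
Proof.
have /finite_seqP[s0 Ds0] := finite_tp_below delta; pose s := undup s0.
have Ds x : x \in s <-> (tp_integers x /\
    forall sigma : {rmorphism K -> algC}, sigma x <= sigma delta).
  by rewrite mem_undup -[x \in s0 : Prop]/([set` s0]%classic x) -Ds0.
have [sigma _] := embedding_exists.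
(* A common bound for the multiplicities: a part x occurs at most sigma(delta) / sigma(x) times. *)
pose N := \max_(x <- s) Num.truncn (sigma delta / sigma x).
pose F (f : {ffun 'I_(size s) -> 'I_N.+1}) : {mset K} :=
  seq_mset (flatten [seq nseq (f j) s`_j | j <- enum 'I_(size s)]).
apply: (@sub_finite_set _ _ (F @` setT)%classic); last exact: finite_image.
move=> lambda [tpl suml].
have lmax x : x \in lambda -> x \in s /\ (lambda x <= N)%N.
  move=> lx; have [_ posx] := tpl x lx.
  have sx : x \in s.
    apply/Ds; split=> [|sg]; first exact: tpl.
    rewrite -suml; apply: le_trans (rmorph_part_le sg x tpl).
    by rewrite -{1}[sg x]mulr1n ler_wpMn2l ?mset_gt0 // ltW; case: (tpl x lx).
  split=> //; rewrite /N (big_rem x) //= leq_max truncn_ge_nat; last first.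
    rewrite divr_ge0 ?(ltW (posx _)) // -suml.
    by apply: le_trans (rmorph_part_le sigma x tpl); rewrite mulrn_wge0 ?ltW.
  by rewrite ler_pdivlMr // mulr_natl -suml rmorph_part_le.
exists [ffun j : 'I_(size s) => inord (lambda s`_j)] => //.
apply/msetP => x; rewrite /F mset_seqE.
have -> : [seq nseq ([ffun j : 'I_(size s) => (inord (lambda s`_j) : 'I_N.+1)] j) s`_j
            | j <- enum 'I_(size s)] = [seq nseq (lambda y) y | y <- s].
  rewrite -[in RHS](mkseq_nth 0 s) /mkseq -val_enum_ord -!map_comp.
  apply: eq_map => j /=; rewrite ffunE inordK // ltnS.
  have [/lmax[]//|] := boolP (s`_j \in lambda).
  by rewrite -mset_eq0 => /eqP ->.
rewrite count_flatten_nseq ?undup_uniq //; case: ifP => // /negP nsx.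
by apply/esym/mset_eq0P/negP => /lmax[].
Qed.

End TotallyPositive.

(** * Scale and primitive factor *)

Section Scale.
Variable K : fieldExtType rat.
Implicit Types (beta gamma delta : K) (lambda : {mset K}).

Lemma integral_mulrn beta n :
  integralOver (intr : int -> K) beta -> integralOver (intr : int -> K) (beta *+ n).
Proof. by move=> intb; rewrite -mulr_natr; apply: integral_mul intb (integral_nat _ n). Qed.

Lemma primitive_tp gamma : primitive_elements gamma -> tp_integers gamma.
Proof. by case. Qed.

(* With u a = v b + 1, the element beta = u gamma' - v gamma satisfies gamma' = a beta. *)
Lemma primitive_coprime gamma gamma' a b : (0 < a)%N -> coprime a b ->
  tp_integers gamma -> primitive_elements gamma' -> gamma *+ a = gamma' *+ b -> a = 1%N.
Proof.
move=> a_gt0 /eqP coab [intg _] [[intg' posg'] primg'] eqab.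
case: (egcdnP b a_gt0) => u v Duv _; rewrite coab in Duv.
pose beta := gamma' *+ u - gamma *+ v.
have Dg' : gamma' = beta *+ a.
  have -> : beta *+ a = gamma' *+ (u * a) - gamma *+ a *+ v.
    by rewrite mulrnBl -!mulrnA (mulnC a).
  by rewrite Duv eqab mulrnDr -mulrnA (mulnC b) addrAC subrr add0r.
have tpb : tp_integers beta.
  split; first by apply: integral_sub; apply: integral_mulrn.
  by move=> s; rewrite -(pmulrn_lgt0 _ a_gt0) -rmorphMn -Dg'.
by case: a a_gt0 Dg' {coab eqab Duv} => [|[|a]] // _ Dg'; case: (primg' a.+2 isT); exists beta.
Qed.

(** After division by the gcd the two multipliers are coprime, and [primitive_coprime], used in both
    directions, shows that both are 1. *)
Lemma primitive_unique gamma gamma' n n' : (0 < n)%N -> (0 < n')%N ->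
  primitive_elements gamma -> primitive_elements gamma' ->
  gamma *+ n = gamma' *+ n' -> n = n' /\ gamma = gamma'.
Proof.
move=> n_gt0 n'_gt0 primg primg' eqn; have d_gt0 : (0 < gcdn n n')%N by rewrite gcdn_gt0 n_gt0.
set d := gcdn n n' in d_gt0.
have Dn : (n = n %/ d * d)%N by rewrite divnK // dvdn_gcdl.
have Dn' : (n' = n' %/ d * d)%N by rewrite divnK // dvdn_gcdr.
set a := (n %/ d)%N in Dn; set b := (n' %/ d)%N in Dn'.
have a_gt0 : (0 < a)%N by move: n_gt0; rewrite Dn muln_gt0 => /andP[].
have b_gt0 : (0 < b)%N by move: n'_gt0; rewrite Dn' muln_gt0 => /andP[].
have coab : coprime a b.
  by rewrite /coprime -(eqn_pmul2r d_gt0) mul1n muln_gcdl -Dn -Dn'.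
have eqab : gamma *+ a = gamma' *+ b.
  by apply: (mulrn_inj d_gt0) => /=; rewrite -!mulrnA -Dn -Dn'.
have a1 := primitive_coprime a_gt0 coab (primitive_tp primg) primg' eqab.
have b1 : b = 1%N.
  by apply: (primitive_coprime b_gt0 _ (primitive_tp primg') primg (esym eqab));
     rewrite coprime_sym.
by rewrite Dn Dn' a1 b1; split=> //; move: eqab; rewrite a1 b1.
Qed.

(** The largest [n] dividing [delta] is taken; by maximality its quotient is primitive. It exists
    because every quotient lies among the finitely many totally positive integers below [delta]. *)
Lemma primitive_factor_exists delta : tp_integers delta ->
  exists n, (0 < n)%N /\ exists2 gamma, primitive_elements gamma & delta = gamma *+ n.
Proof.
move=> tpd; pose Q n := `[< (0 < n)%N /\ exists2 beta, tp_integers beta & delta = beta *+ n >].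
have Q1 : exists n, Q n by exists 1%N; apply/asboolP; split=> //; exists delta.
have [sigma _] := embedding_exists K.
have /finite_seqP[s Ds] := finite_tp_below delta.
have Qmax n : Q n -> (n <= \max_(x <- s) Num.truncn (sigma delta / sigma x))%N.
  case/asboolP=> n_gt0 [beta tpb Dd]; have [_ posb] := tpb.
  have sb : beta \in s.
    rewrite -[beta \in s : Prop]/([set` s]%classic beta) -Ds; split=> // sg.
    by rewrite Dd rmorphMn -{1}[sg beta]mulr1n ler_wpMn2l // ltW.
  have quot : sigma delta / sigma beta = n%:R.
    by rewrite Dd rmorphMn -mulr_natl mulfK ?gt_eqF.
  by rewrite (big_rem beta) //= leq_max quot truncn_ge_nat ?lexx ?ler0n.
case: (ex_maxnP Q1 Qmax) => n /asboolP[n_gt0 [gamma tpg Dd]] nmax.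
exists n; split=> //; exists gamma => //; split=> // m m_gt1 [beta tpb Dg].
have /nmax : Q (m * n)%N.
  apply/asboolP; split; first by rewrite muln_gt0 n_gt0 ltnW.
  by exists beta => //; rewrite mulrnA -Dg.
by rewrite leqNgt ltn_Pmull.
Qed.

Definition primitive_factor delta : K :=
  xget 0 [set gamma | primitive_elements gamma /\ delta = gamma *+ scale delta]%classic.

Lemma scaleP delta : tp_integers delta ->
  [/\ (0 < scale delta)%N, primitive_elements (primitive_factor delta)
    & delta = primitive_factor delta *+ scale delta].
Proof.
move=> tpd; have [n Dn] := primitive_factor_exists tpd.
have [s_gt0 [gamma primg Dd]] := @xgetPex _ 0%N
  [set n : nat | (0 < n)%N /\ exists2 gamma, primitive_elements gamma & delta = gamma *+ n]%classic
  (ex_intro _ n Dn).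
have [primt Dt] := @xgetPex _ 0
  [set gamma | primitive_elements gamma /\ delta = gamma *+ scale delta]%classic
  (ex_intro _ gamma (conj primg Dd)).
by [].
Qed.

Lemma scale_mulrn gamma n : primitive_elements gamma -> (0 < n)%N ->
  scale (gamma *+ n) = n /\ primitive_factor (gamma *+ n) = gamma.
Proof.
move=> primg n_gt0; have [s_gt0 primt Dd] := scaleP (tp_mulrn n_gt0 (primitive_tp primg)).
by have [] := primitive_unique n_gt0 s_gt0 primg primt Dd.
Qed.

End Scale.

(** * Componentwise classes of partitions *)

Section Components.
Variable K : fieldExtType rat.
Implicit Types (beta gamma delta : K) (lambda : {mset K}) (s g : seq K) (b : K -> seq nat).

(* If lambda is the sum of the lambda^(gamma), gamma primitive, then lambda^(gamma)
   consists of the multiples b gamma for b in [component lambda gamma]. *)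
Definition component s gamma : seq nat :=
  sort geq [seq scale beta | beta <- s & primitive_factor beta == gamma].

Definition assemble b g : seq K := flatten [seq [seq gamma *+ n | n <- b gamma] | gamma <- g].

Lemma geq_total : total geq.
Proof. by move=> m n; apply: leq_total. Qed.

Lemma geq_trans : transitive geq.
Proof. exact: rev_trans leq_trans. Qed.

Lemma geq_anti : antisymmetric geq.
Proof. by move=> m n; rewrite andbC; apply: anti_leq. Qed.

Lemma component_perm s s' gamma : perm_eq s s' -> component s gamma = component s' gamma.
Proof.
move=> eqs; apply/(perm_sortP geq_total geq_trans geq_anti).
exact/perm_map/perm_filter.
Qed.

Lemma component_part s gamma : (forall beta, beta \in s -> tp_integers beta) ->
  is_part (component s gamma).
Proof.
move=> tps; rewrite /is_part sort_sorted ?all_sort; last exact: geq_total.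
apply/allP => n /mapP[beta]; rewrite mem_filter => /andP[_ /tps tpb] ->.
by have [] := scaleP tpb.
Qed.

Lemma component_nil s gamma : gamma \notin [seq primitive_factor beta | beta <- s] ->
  component s gamma = [::].
Proof.
move=> ngs; rewrite /component (@eq_in_filter _ _ pred0) ?filter_pred0 // => beta sb /=.
by apply: contraNF ngs => /eqP <-; apply: map_f.
Qed.

Lemma mem_assemble b g beta : beta \in assemble b g ->
  exists gamma n, [/\ gamma \in g, n \in b gamma & beta = gamma *+ n].
Proof.
by case/flattenP => _ /mapP[gamma gg ->] /mapP[n bn ->]; exists gamma, n.
Qed.

Lemma assemble_tp b g :
  (forall gamma, gamma \in g -> primitive_elements gamma /\ is_part (b gamma)) ->
  forall beta, beta \in assemble b g -> tp_integers beta.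
Proof.
move=> gP _ /mem_assemble[gamma [n [/gP[primg /andP[_ posb]] bn ->]]].
by apply: tp_mulrn (primitive_tp primg); apply: (allP posb).
Qed.

(** By uniqueness of scale and primitive factor, only the block of [gamma] contributes, and the
    scales return its list. *)
Lemma component_assemble b g gamma : uniq g ->
  (forall gamma, gamma \in g -> primitive_elements gamma /\ is_part (b gamma)) ->
  component (assemble b g) gamma = if gamma \in g then b gamma else [::].
Proof.
move=> uniqg gP; transitivity (sort geq (if gamma \in g then b gamma else [::])); last first.
  case: ifP => // /gP[_ /andP[sb _]]; apply: sorted_sort sb; exact: geq_trans.
congr (sort _ _); elim: g uniqg gP => //= a g IHg /andP[nga uniqg] gP.
have [prima /andP[_ posa]] := gP a (mem_head a g).
rewrite /assemble /= filter_cat map_cat -/(assemble b g) IHg //; last first.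
  by move=> c gc; apply: gP; rewrite inE gc orbT.
have sP n : n \in b a -> scale (a *+ n) = n /\ primitive_factor (a *+ n) = a.
  by move=> /(allP posa); apply: scale_mulrn.
rewrite filter_map -map_comp inE; case: eqVneq => [Da|neqa] /=.
  rewrite Da (negbTE nga) cats0 (@eq_in_filter _ _ predT) ?filter_predT => [|n /sP[_ /= ->]].
    by rewrite -[RHS]map_id; apply/eq_in_map => n /sP[].
  by rewrite eqxx.
rewrite (@eq_in_filter _ _ pred0) ?filter_pred0 // => n /sP[_ /= ->].
by rewrite eq_sym (negbTE neqa).
Qed.

(** The parts are grouped by primitive factor; [g] has to contain every factor that occurs, and may
    contain others, whose components are empty. *)
Lemma assemble_component s g : uniq g -> (forall beta, beta \in s -> tp_integers beta) ->
  {subset [seq primitive_factor beta | beta <- s] <= g} ->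
  perm_eq (assemble (component s) g) s.
Proof.
move=> uniqg tps sub.
suff H : perm_eq (assemble (component s) g) [seq beta <- s | primitive_factor beta \in g].
  rewrite (perm_trans H) // (@eq_in_filter _ _ predT) ?filter_predT // => beta sb /=.
  by apply: sub; apply: map_f.
elim: g uniqg {sub} => [_|a g IHg /= /andP[nga uniqg]] /=.
  by rewrite /assemble /= (@eq_filter _ _ pred0) ?filter_pred0.
rewrite /assemble /= -/(assemble _ g).
set t := [seq beta <- s | _ \in a :: g].
rewrite perm_sym -(perm_filterC (fun beta => primitive_factor beta == a) t) perm_sym.
apply: perm_cat.
  rewrite /t -filter_predI.
  rewrite (@eq_filter _ _ (fun beta => primitive_factor beta == a)); last first.
    by move=> beta /=; rewrite inE; case: eqP.
  have eqc : perm_eq (component s a)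
      [seq scale beta | beta <- s & primitive_factor beta == a] by rewrite perm_sort.
  apply: perm_trans (perm_map _ eqc) _; rewrite -map_comp.
  rewrite -[X in perm_eq _ X]map_id; set X := map _ _; set Y := map _ _.
  suff -> : X = Y by []; apply/eq_in_map => beta; rewrite mem_filter => /andP[/eqP <- /tps tpb] /=.
  by have [_ _ {3}->] := scaleP tpb.
apply: perm_trans (IHg uniqg) _; rewrite /t -filter_predI; set X := filter _ _; set Y := filter _ _.
suff -> : X = Y by []; apply: eq_filter => beta /=; rewrite inE; case: eqVneq => //= ->.
exact: negbTE.
Qed.

Lemma sum_assemble b g :
  \sum_(x <- assemble b g) x = \sum_(gamma <- g) gamma *+ sumn (b gamma).
Proof.
rewrite big_flatten big_map; apply: eq_bigr => gamma _.
rewrite big_map; elim: (b gamma) => [|n r IHr]; first by rewrite big_nil.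
by rewrite big_cons IHr /= mulrnDr.
Qed.

End Components.

Lemma leq_card_fset_set (T U : choiceType) (A : set T) (B : set U) (f : T -> U) :
  finite_set A -> finite_set B -> (forall x, A x -> B (f x)) ->
  (forall x y, A x -> A y -> f x = f y -> x = y) ->
  (#|` fset_set A| <= #|` fset_set B|)%N.
Proof.
move=> finA finB fAB injf.
have inA x : x \in fset_set A -> A x by rewrite in_fset_set // => /set_mem.
have <- : #|` (f @` fset_set A)%fset| = #|` fset_set A|.
  by rewrite card_in_imfset // => x y /inA Ax /inA Ay; apply: injf.
apply: fsubset_leq_card; apply/fsubsetP => _ /imfsetP[x /= /inA Ax ->].
by rewrite in_fset_set //; apply/mem_set/fAB.
Qed.

(** * Transfer of injections from components to partitions *)

Section Transfer.
Variable K : fieldExtType rat.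
Implicit Types (beta gamma delta : K) (lambda : {mset K}) (C D : seq nat -> Prop).

Definition componentwise C : set {mset K} :=
  [set lambda : {mset K} | forall gamma, primitive_elements gamma ->
     C (component lambda gamma)]%classic.

Section Map.
Variables (C D : seq nat -> Prop) (phi : seq nat -> seq nat).
Hypothesis phiP : forall b, is_part b -> C b ->
  [/\ is_part (phi b), sumn (phi b) = sumn b & D (phi b)].
Hypothesis phi_inj : forall b b', is_part b -> C b -> is_part b' -> C b' ->
  phi b = phi b' -> b = b'.

Definition factors lambda : seq K := undup [seq primitive_factor beta | beta <- lambda].
Definition map_components lambda : {mset K} :=
  seq_mset (assemble (phi \o component lambda) (factors lambda)).

(** A list of positive parts with sum 0 is empty. Hence applying [phi] only at the finitely many
    factors of a partition agrees with applying it at every primitive element. *)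
Lemma phi_nil : C [::] -> phi [::] = [::].
Proof.
move=> C0; have [//|/andP[_ posf] sumf _] := phiP _ C0.
by case: (phi [::]) posf sumf => // x r /= /andP[]; case: x.
Qed.

Section OnePartition.
Variable lambda : {mset K}.
Hypotheses (tpl : forall beta, beta \in lambda -> tp_integers beta)
  (Cl : componentwise C lambda).

Lemma factorsP gamma : gamma \in factors lambda ->
  primitive_elements gamma /\ is_part ((phi \o component lambda) gamma).
Proof.
rewrite mem_undup => /mapP[beta /tpl tpb ->]; have [_ primt _] := scaleP tpb.
by split=> //; have [] := phiP (component_part _ tpl) (Cl primt).
Qed.

Lemma component_map gamma : primitive_elements gamma ->
  component (map_components lambda) gamma = phi (component lambda gamma).
Proof.
move=> primg; rewrite (component_perm _ (perm_eq_seq_mset _)).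
rewrite (component_assemble _ (undup_uniq _) factorsP); case: ifP => // /negbT.
rewrite mem_undup => ngl; have := Cl primg.
by rewrite component_nil // => /phi_nil.
Qed.

Lemma map_components_tp beta : beta \in map_components lambda -> tp_integers beta.
Proof. by rewrite (perm_mem (perm_eq_seq_mset _)); apply: assemble_tp; apply: factorsP. Qed.

Lemma sum_map_components : \sum_(x <- map_components lambda) x = \sum_(x <- lambda) x.
Proof.
have subl : {subset [seq primitive_factor beta | beta <- lambda] <= factors lambda}.
  by move=> gamma; rewrite mem_undup.
rewrite (perm_big _ (perm_eq_seq_mset _)) /= sum_assemble.
rewrite -[RHS](perm_big _ (assemble_component (undup_uniq _) tpl subl)) /= sum_assemble.
apply: eq_big_seq => gamma /factorsP[primg _] /=.
by have [_ ->] := phiP (component_part gamma tpl) (Cl primg).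
Qed.

Lemma map_componentsP : componentwise D (map_components lambda).
Proof.
move=> gamma primg; rewrite component_map //.
by have [] := phiP (component_part gamma tpl) (Cl primg).
Qed.

End OnePartition.

Lemma map_components_inj lambda lambda' :
  (forall beta, beta \in lambda -> tp_integers beta) -> componentwise C lambda ->
  (forall beta, beta \in lambda' -> tp_integers beta) -> componentwise C lambda' ->
  map_components lambda = map_components lambda' -> lambda = lambda'.
Proof.
move=> tpl Cl tpl' Cl' eqPhi.
(* A common list of factors, so that both partitions are reassembled over the same index set. *)
pose g := undup ([seq primitive_factor beta | beta <- lambda]
                 ++ [seq primitive_factor beta | beta <- lambda']).
have primg gamma : gamma \in g -> primitive_elements gamma.
  rewrite mem_undup mem_cat.
  by case/orP=> /mapP[beta lb ->]; [case: (scaleP (tpl _ lb)) | case: (scaleP (tpl' _ lb))].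
have subl : {subset [seq primitive_factor beta | beta <- lambda] <= g}.
  by move=> x lx; rewrite mem_undup mem_cat lx.
have subl' : {subset [seq primitive_factor beta | beta <- lambda'] <= g}.
  by move=> x lx; rewrite mem_undup mem_cat lx orbT.
rewrite -(seq_mset_id lambda) -(seq_mset_id lambda'); apply/eq_seq_msetP.
have := assemble_component (undup_uniq _) tpl' subl'.
have := assemble_component (undup_uniq _) tpl subl.
rewrite perm_sym /assemble (_ : [seq _ | gamma <- g] =
  [seq [seq gamma *+ n | n <- component lambda' gamma] | gamma <- g]); first exact: perm_trans.
apply/eq_in_map => gamma /primg pg; congr map.
apply: phi_inj; [exact: component_part|exact: Cl|exact: component_part|exact: Cl'|].
by rewrite -!component_map // eqPhi.
Qed.

Lemma componentwise_leq delta :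
  (num_partitions (componentwise C) delta <= num_partitions (componentwise D) delta)%N.
Proof.
have fin E : finite_set (componentwise E `&` partitions_of delta)%classic.
  by apply: sub_finite_set (@finite_partitions K delta) => x [].
apply: (leq_card_fset_set (f := map_components)) => //.
  move=> lambda [Cl [tpl <-]]; split; first exact: map_componentsP.
  by split; [exact: map_components_tp | exact: sum_map_components].
by move=> lambda lambda' [Cl [tpl _]] [Cl' [tpl' _]]; apply: map_components_inj.
Qed.
End Map.

Lemma enumerates_map C D :
  (forall n, exists U V, [/\ size U = size V, enumerates n C U & enumerates n D V]) ->
  exists phi : seq nat -> seq nat,
    (forall b, is_part b -> C b ->
       [/\ is_part (phi b), sumn (phi b) = sumn b & D (phi b)]) /\
    (forall b b', is_part b -> C b -> is_part b' -> C b' -> phi b = phi b' -> b = b').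
Proof.
move=> enumCD.
have {}enumCD n : exists UV : seq (seq nat) * seq (seq nat),
    [/\ size UV.1 = size UV.2, enumerates n C UV.1 & enumerates n D UV.2].
  by have [U [V UV]] := enumCD n; exists (U, V).
pose U n := (sval (cid (enumCD n))).1; pose V n := (sval (cid (enumCD n))).2.
have UVP n : [/\ size (U n) = size (V n), enumerates n C (U n) & enumerates n D (V n)].
  by rewrite /U /V; case: cid.
(* Each list goes to the list in the same position of the other enumeration for the same sum. *)
pose phi b := nth [::] (V (sumn b)) (index b (U (sumn b))).
have memU b : is_part b -> C b -> b \in U (sumn b).
  by move=> pb Cb; have [_ [_ UP] _] := UVP (sumn b); apply/UP.
have ltV b : is_part b -> C b -> (index b (U (sumn b)) < size (V (sumn b)))%N.
  by move=> pb Cb; have [<- _ _] := UVP (sumn b); rewrite index_mem memU.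
have phiP b : is_part b -> C b -> [/\ is_part (phi b), sumn (phi b) = sumn b & D (phi b)].
  move=> pb Cb; have [_ _ [_ VP]] := UVP (sumn b).
  by apply/VP/mem_nth/ltV.
exists phi; split=> // b b' pb Cb pb' Cb' eqphi.
have eqs : sumn b = sumn b'.
  by have [_ <- _] := phiP _ pb Cb; have [_ <- _] := phiP _ pb' Cb'; rewrite eqphi.
have [_ _ [uniqV _]] := UVP (sumn b).
move/eqP: eqphi; rewrite /phi -eqs nth_uniq ?ltV //; last by rewrite eqs ltV.
by move/eqP/index_inj; apply; rewrite ?memU // eqs memU.
Qed.

(** Two inequalities between finite counts, each from an injection on components, with [C] and [D]
    exchanged. *)
Theorem componentwise_eq C D delta :
  (forall n, exists U V, [/\ size U = size V, enumerates n C U & enumerates n D V]) ->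
  num_partitions (componentwise C) delta = num_partitions (componentwise D) delta.
Proof.
move=> enumCD; apply/eqP; rewrite eqn_leq; apply/andP; split.
  by have [phi [phiP phi_inj]] := enumerates_map enumCD; apply: componentwise_leq phi_inj delta.
have [n|phi [phiP phi_inj]] := @enumerates_map D C.
  by have [U [V [szUV enC enD]]] := enumCD n; exists V, U.
exact: componentwise_leq phi_inj delta.
Qed.

End Transfer.

(** * The two classes as componentwise conditions *)

Lemma gordon_residueP k i n : (0 < i)%N -> (i <= k)%N ->
  (forall r : int, r \in [:: 0; i%:Z; - i%:Z] ->
     (n%:Z != r %[mod (2 * k + 1)%N%:Z])%Z) <-> ~~ gordon_residue k i n.
Proof.
move=> i_gt0 leik; set M := (2 * k + 1)%N.
have modN : ((- i%:Z) %% M%:Z)%Z = (M - i)%N.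
  rewrite -modzDr (_ : - i%:Z + M%:Z = (M - i)%N%:Z) ?modz_nat ?modn_small //;
    first by rewrite /M; lia.
  by rewrite -subzn 1?addrC //; rewrite /M; lia.
have modi : (i%:Z %% M%:Z)%Z = i by rewrite modz_nat modn_small // /M; lia.
rewrite /gordon_residue -/M !negb_or; split=> [H|/and3P[n0 ni nN] r].
  have := H 0; have := H i%:Z; have := H (- i%:Z).
  rewrite !inE !eqxx ?orbT modN modi mod0z modz_nat !eqz_nat.
  by move=> /(_ isT) -> /(_ isT) -> /(_ isT) ->.
rewrite !inE => /or3P[] /eqP->; rewrite ?modN ?modi ?mod0z modz_nat eqz_nat //.
Qed.

Section Classes.
Variables (K : fieldExtType rat) (k i : nat).
Hypotheses (i_gt0 : (0 < i)%N) (leik : (i <= k)%N).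
Implicit Types (lambda : {mset K}) (delta : K).

Lemma A'_componentwise lambda : (forall beta, beta \in lambda -> tp_integers beta) ->
  A' k i lambda <-> componentwise (fun b => all (predC (gordon_residue k i)) b) lambda.
Proof.
move=> tpl; split=> [Al gamma _|Cl beta lb].
  rewrite all_sort; apply/allP => _ /mapP[beta] + ->; rewrite mem_filter => /andP[_ lb] /=.
  by apply/gordon_residueP => //; case: (Al beta lb).
have tpb := tpl beta lb; have [_ primt _] := scaleP tpb.
split=> //; apply/gordon_residueP => //.
have := Cl _ primt; rewrite all_sort => /allP; apply.
by apply: map_f; rewrite mem_filter eqxx.
Qed.

Lemma big_msetD_seq_mset (I : Type) (F : I -> seq K) (r : seq I) :
  \big[@msetD K/mset0]_(h <- r) seq_mset (F h) = seq_mset (flatten [seq F h | h <- r]).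
Proof.
elim: r => [|h r IHr]; first by rewrite big_nil; apply/msetP => x; rewrite mset_seqE mset0E.
by rewrite big_cons IHr; apply/msetP => x; rewrite msetE2 !mset_seqE /= count_cat.
Qed.

Lemma gordon_seq_nil : gordon_seq k i [::].
Proof. by split=> //; rewrite leqNgt i_gt0. Qed.

Lemma B'_componentwise lambda : (forall beta, beta \in lambda -> tp_integers beta) ->
  B' k i lambda <-> componentwise (gordon_seq k i) lambda.
Proof.
move=> tpl; split=> [[l [gam [mu [gam_inj primgam Bmu Dl]]]] gamma primg|Cl].
  have {}Bmu h : exists b, [/\ is_part b, gordon_seq k i b
      & mu h = seq_mset [seq gam h *+ n | n <- b]].
    have [b [sb posb gap ones Dmu]] := Bmu h; exists b; split=> //.
    by rewrite /is_part sb; apply/allP.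
  pose b h := sval (cid (Bmu h)).
  have bP h : [/\ is_part (b h), gordon_seq k i (b h)
      & mu h = seq_mset [seq gam h *+ n | n <- b h]] by rewrite /b; case: cid.
  (* The list attached to a primitive element; it is determined because [gam] is injective, and it
     is empty outside the image of [gam]. *)
  pose c g := if [pick h | gam h == g] is Some h then b h else [::].
  have cE h : c (gam h) = b h.
    rewrite /c; case: pickP => [h' /eqP/gam_inj -> //|/(_ h)]; by rewrite eqxx.
  have Dl' : lambda = seq_mset (assemble c [seq gam h | h <- index_enum 'I_l]).
    rewrite Dl (eq_bigr (fun h => seq_mset [seq gam h *+ n | n <- c (gam h)])).
      by rewrite big_msetD_seq_mset /assemble -map_comp.
    by move=> h _; rewrite cE; case: (bP h).
  rewrite Dl' (component_perm _ (perm_eq_seq_mset _)) component_assemble.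
  - case: ifP => [/mapP[h _ ->]|_]; last exact: gordon_seq_nil.
    by rewrite cE; case: (bP h).
  - by rewrite map_inj_uniq ?index_enum_uniq.
  by move=> _ /mapP[h _ ->]; rewrite cE; split=> //; case: (bP h).
(* Conversely, the distinct primitive factors of [lambda] serve as the family of gammas. *)
pose g := undup [seq primitive_factor beta | beta <- lambda].
have primg gamma : gamma \in g -> primitive_elements gamma.
  by rewrite mem_undup => /mapP[beta /tpl /scaleP[_ primt _] ->].
pose gam (h : 'I_(size g)) := g`_h.
have gamP h : primitive_elements (gam h) by apply/primg/mem_nth.
exists (size g), gam, (fun h => seq_mset [seq gam h *+ n | n <- component lambda (gam h)]).
split=> //.
- move=> h h' /eqP; rewrite nth_uniq ?undup_uniq // => /eqP; exact: val_inj.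
- move=> h; exists (component lambda (gam h)).
  have /andP[sb /allP posb] := component_part (gam h) tpl.
  by have [gap ones] := Cl _ (gamP h); split.
rewrite big_msetD_seq_mset -[LHS]seq_mset_id; apply/eq_seq_msetP; rewrite perm_sym.
have -> : [seq [seq gam h *+ n | n <- component lambda (gam h)] | h <- index_enum 'I_(size g)]
  = [seq [seq gamma *+ n | n <- component lambda gamma] | gamma <- g].
  rewrite -[in RHS](mkseq_nth 0 g) /mkseq -val_enum_ord -!map_comp.
  by rewrite [index_enum _]unlock -enumT.
by apply: assemble_component; rewrite ?undup_uniq // => x; rewrite mem_undup.
Qed.

Lemma num_partitions_eq (C D : set {mset K}) delta :
  (forall lambda, (forall beta, beta \in lambda -> tp_integers beta) -> C lambda <-> D lambda) ->
  num_partitions C delta = num_partitions D delta.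
Proof.
move=> CD; rewrite /num_partitions; congr (#|` fset_set _|).
apply/seteqP; split=> lambda [Cl [tpl suml]]; split=> //; exact/CD.
Qed.

End Classes.

Theorem theorem3p6 (K : fieldExtType rat) (hK : totally_real K)
    (k i : nat) (hi : (1 <= i)%N) (hik : (i <= k)%N)
    (delta : K) (hdelta : tp_integers delta) :
  finite_set (partitions_of delta) /\
  num_partitions (A' k i) delta = num_partitions (B' k i) delta.
Proof.
(* Finiteness makes [num_partitions] a genuine count, since [fset_set] is empty by default on
   infinite sets. *)
split; first exact: finite_partitions.
rewrite (num_partitions_eq delta (A'_componentwise hi hik)).
rewrite (num_partitions_eq delta (B'_componentwise k hi)).
by apply: componentwise_eq => n; apply: gordon_enum.
Qed.
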